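(* Let $(\mathcal{X},c)$ be a complete separable metric space. Let $\{P_{\alpha}\}_{\alpha\in\mathcal{A}}$ be a finite collection of probability distributions over $\mathcal{X}$ with $|\mathcal{A}|\ge2$. Then \[ r_{c}^{*}(\{P_{\alpha}\}_{\alpha\in\mathcal{A}})<23.1\cdot\log|\mathcal{A}|. \]
   Context: Logarithms are natural. Polish spaces carry their Borel $\sigma$-algebras. A coupling of a collection $\{P_\alpha\}_{\alpha\in\mathcal{A}}$ of probability distributions over $\mathcal{X}$ is a family of random variables $X_\alpha:[0,1]\to\mathcal{X}$, all defined on the standard probability space ($[0,1]$, Lebesgue measurable sets, Lebesgue measure), with $X_\alpha\sim P_\alpha$ for every $\alpha$. For probability distributions $P,Q$ over $\mathcal{X}$, $C_c^*(P,Q):=\inf\mathbf{E}[c(X,Y)]$ over couplings $(X,Y)$ of $(P,Q)$. The pairwise coupling ratio of a coupling is $r_c(\{X_\alpha\}_{\alpha}):=\inf\{r\ge1:\mathbf{E}[c(X_\alpha,X_\beta)]\le r\,C_c^*(P_\alpha,P_\beta)\ \forall\alpha,\beta\in\mathcal{A}\}$ ($\infty$ if no such $r$ exists), and $r_c^*(\{P_\alpha\}_{\alpha}):=\inf r_c(\{X_\alpha\}_\alpha)$ over all couplings of $\{P_\alpha\}_\alpha$. *)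

(* Defs.v *)
From HB Require Import structures.
From mathcomp Require Import all_boot all_order all_algebra.
From mathcomp Require Import all_classical all_reals all_analysis.

Set Implicit Arguments.
Unset Strict Implicit.
Unset Printing Implicit Defensive.

Import Order.TTheory GRing.Theory Num.Theory.
Import numFieldNormedType.Exports.

Local Open Scope classical_set_scope.
Local Open Scope ring_scope.

(* The structure [Complete] includes a distinguished point. This excludes only
   the empty space, which carries no probability measure. *)
#[short(type="completeMetricType")]
HB.structure Definition CompleteMetric (K : numDomainType) :=
  {M of Metric K M & Complete M}.

Definition separable (T : topologicalType) : Prop :=
  exists2 D : set T, countable D & dense D.

Notation borel T := (g_sigma_algebraType (@open T)).

(* The real line with the Lebesgue measurable sets (rather than the Borel sets),
   the carrier of [completed_lebesgue_measure]. *)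
Notation lebesgueType R := (caratheodory_type (@wlength R idfun)^*%mu).

Definition unit_interval {R : realType} : set (lebesgueType R) :=
  [set` `[0 : R, 1 : R]].

Section couplings.
Context {R : realType} {d : measure_display} {X : measurableType d}.
Local Open Scope ereal_scope.

Local Notation leb := (@completed_lebesgue_measure R).
Local Notation I := (@unit_interval R).

(* A random variable on the standard probability space [0, 1] is a function on
   the line whose values outside [0, 1] are irrelevant. *)
Definition has_law (P : probability X R) (x : lebesgueType R -> X) : Prop :=
  measurable_fun I x /\
  forall B : set X, measurable B -> leb (I `&` x @^-1` B) = P B.

Definition coupling (A : Type) (P : A -> probability X R)
    (x : A -> lebesgueType R -> X) : Prop :=
  forall a, has_law (P a) (x a).

Variable c : X -> X -> R.

Definition expected_cost (x y : lebesgueType R -> X) : \bar R :=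
  \int[leb]_(t in I) (c (x t) (y t))%:E.

Definition transport_cost (P Q : probability X R) : \bar R :=
  ereal_inf [set e | exists x y,
    [/\ has_law P x, has_law Q y & e = expected_cost x y]].

Definition coupling_ratio (A : Type) (P : A -> probability X R)
    (x : A -> lebesgueType R -> X) : \bar R :=
  ereal_inf [set r%:E | r in [set r : R | (1 <= r)%R /\
    forall a b, expected_cost (x a) (x b) <=
                r%:E * transport_cost (P a) (P b)]].

Definition optimal_coupling_ratio (A : Type) (P : A -> probability X R)
    : \bar R :=
  ereal_inf [set coupling_ratio P x | x in [set x | coupling P x]].

End couplings.

(* Main.v *)
Require Import Defs.
From HB Require Import structures.
From mathcomp Require Import all_boot all_order all_algebra all_fingroup.
From mathcomp Require Import all_classical all_reals all_analysis.
From mathcomp Require Import measurable_realfun zify ring lra.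

(** Let W (a, b) be the transport cost between [P a] and [P b]. It satisfies
    the triangle inequality, so up to infinite values it is a metric on the
    finite set [A], and the theorem is an instance of the embedding of finite
    metrics into random trees (Fakcharoenphol, Rao and Talwar): if the laws are
    the vertices of a tree, then running along the tree and drawing each
    variable from its parent by an optimal coupling gives a joint coupling in
    which the cost between two variables is at most their distance in the tree;
    a random tree whose expected distances exceed W by a factor O (log n)
    then gives the claim.

    The random tree comes from a uniformly random order on [A] and a random
    scale [x] in [4 ^ m, 4 ^ m.+1), drawn with probability proportional to
    1 / x. At level [j] a point [u] is sent to its center, the first point of
    the order within distance x / 4 ^ j of [u] ([cluster_center]). At level 0
    two points at finite distance have the same center; at level [m.+1] every
    point is its own center. The coupling follows the chain of centers of each
    point, all chains using the same source of randomness at each level, so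
    that two points carry the same variable as long as their chains agree
    ([chain_coupling]). If the chains of [u] and [v] part at level [j], the
    steps from there on cost at most (40 / 3) x / 4 ^ j, by a geometric sum
    ([hierarchical_coupling]). They part at level [j] because of some [w] which
    is within the radius x / 4 ^ j of one of [u], [v] but not of the other, and
    which precedes in the order all points closer to the pair than itself; for
    the k-th closest point the latter has probability 1 / k. As [x] has density
    proportional to 1 / x, the radii summed over the levels contribute at most
    W (u, v) / Z for each [w], where Z is the sum of the 1 / x
    ([expected_cut_scales]). With H_n the harmonic sum, the distortion is
    (40 / 3) H_n / Z, and Z >= 2 ln 2 and H_n <= (3 / 2) log_2 n bound it by
    10 ln n / (ln 2) ^ 2 < 22.9 ln n ([distortion_lt]).

    Conditional laws on the space itself are avoided by discretizing. A
    countable partition of the space into cells of diameter of order [eps]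
    replaces the laws by laws on the naturals, for which the conditional law
    given a value is a quotient ([transition_map]), and changes all costs by
    O (eps) ([discrete_cost_le_transport], [cost_le_cell]). Conversely a joint law of
    cells is realized on the unit interval by cutting it into intervals on which
    the cells are constant, and by filling each of them with the restriction of
    the given laws to these cells ([realize_weights]); this uses that every
    finite Borel measure on a Polish space is the image of Lebesgue measure on
    an interval ([realize_measure_on_interval]). The additive errors fit in the
    gap between 22.9 and 23.1, because the finitely many positive transport
    costs are bounded below, and a transport cost vanishes only between equal
    laws ([transport_cost_eq0]), which receive the same variable. *)

Set Implicit Arguments.
Unset Strict Implicit.
Unset Printing Implicit Defensive.

Import Order.TTheory GRing.Theory Num.Theory.
Import numFieldNormedType.Exports.

Local Open Scope ring_scope.

(** * Random hierarchical clustering of a finite metric space *)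

Section first_in_random_order.
Variable A : finType.

(** The position of [w] in the order of [A] given by the permutation [s]. *)
Definition prio (s : {perm A}) (w : A) : nat := enum_rank (s w).

Lemma prio_inj s : injective (prio s).
Proof. by move=> u v /ord_inj/enum_rank_inj/perm_inj. Qed.

Definition first_perms (S : {set A}) (w : A) : {set {perm A}} :=
  [set s | [forall v in S, (prio s w <= prio s v)%N]].

Lemma card_first_perms_le (S : {set A}) w w' : w \in S -> w' \in S ->
  (#|first_perms S w| <= #|first_perms S w'|)%N.
Proof.
move=> wS w'S; rewrite -(card_imset _ (mulgI (tperm w w'))).
apply/subset_leq_card/fintype.subsetP => _ /imsetP[s + ->].
rewrite !inE => /forall_inP sw; apply/forall_inP => v vS.
rewrite /prio !permM tpermR; case: tpermP => [_|_|_ _]; exact: sw.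
Qed.

(** Transposing [w] with another element of [S] shows that every element
    of [S] is equally likely to come first. *)
Lemma card_first_perms (S : {set A}) w : w \in S ->
  (#|S| * #|first_perms S w| <= #|{perm A}|)%N.
Proof.
move=> wS; rewrite -sum_nat_const.
apply: (@leq_trans (\sum_(v in S) #|first_perms S v|)).
  by apply: leq_sum => v vS; exact: card_first_perms_le.
under eq_bigr do rewrite -sum1_card.
rewrite (exchange_big_dep predT)//= -sum1_card leq_sum// => s _.
rewrite sum1_card; apply/card_le1_eqP => u v /andP[uS us] /andP[vS vs].
move: us vs; rewrite !inE => /forall_inP us /forall_inP vs.
by apply: (@prio_inj s); apply/eqP; rewrite eqn_leq us// vs.
Qed.

End first_in_random_order.

(** When [A] is sorted by [f], the k-th element has at least [k] elements
    [v] with [f v] below its value; ties only increase this number. *)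
Lemma sum_inv_rank (F : realFieldType) (A : finType) (f : A -> nat) :
  \sum_(w : A) (#|[set v | (f v <= f w)%N]|%:R : F)^-1 <=
  \sum_(k < #|A|) (k.+1%:R)^-1.
Proof.
pose le := [rel u v | (f u <= f v)%N].
have le_tr : transitive le by move=> y x z; exact: leq_trans.
have le_tot : total le by move=> x y; exact: leq_total.
pose s := sort le (enum A).
have ps : perm_eq (index_enum A) s by rewrite perm_sym perm_sort enumT.
have ss : size s = #|A| by rewrite size_sort -cardE.
rewrite (perm_big _ ps)/=.
case: (pickP A) => [w0 _|A0]; last first.
  have -> : s = [::] by apply: size0nil; rewrite ss; exact: eq_card0.
  by rewrite big_nil sumr_ge0// => k _; rewrite invr_ge0 ler0n.
rewrite (big_nth w0) ss big_mkord ler_sum// => k _.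
rewrite lef_pV2 ?posrE ?ltr0n//; last first.
  by rewrite finset.card_gt0; apply/finset.set0Pn; exists (nth w0 s k); rewrite inE.
rewrite ler_nat.
have us : uniq s by rewrite sort_uniq enum_uniq.
have sk : size (take k.+1 s) = k.+1 by rewrite size_takel// ss.
rewrite -[X in (X <= _)%N]sk -(card_uniqP (take_uniq _ us)).
apply/subset_leq_card/fintype.subsetP => v /(nthP w0)[i]; rewrite sk => ik <-.
rewrite nth_take// inE.
have := sorted_leq_nth le_tr (fun x => leqnn (f x)) w0 (sort_sorted le_tot (enum A)).
by apply; rewrite ?inE ?ss// (leq_trans ik).
Qed.

(** A radius [k], up to rounding, is reached at a single level, since the
    radii x / 4 ^ j of level [j] fill the interval from 4 ^ (m - j) to 4 ^
    (m + 1 - j), and these intervals are disjoint; at that level at most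
    [4 ^ j] values of [x] are rounded to [k]. *)
Lemma count_scales (F : realFieldType) (m k : nat) :
  \sum_(4 ^ m <= x < 4 ^ m.+1) \sum_(j < m.+2)
    ((x %/ 4 ^ j)%N == k)%:R / 4 ^+ j <= 1 :> F.
Proof.
rewrite exchange_big/=.
have pw j : (0 < 4 ^ j)%N by rewrite expn_gt0.
have term (j : 'I_m.+2) : \sum_(4 ^ m <= x < 4 ^ m.+1)
    ((x %/ 4 ^ j)%N == k)%:R / 4 ^+ j <= 1 :> F.
  rewrite -big_distrl/= ler_pdivrMr ?exprn_gt0// mul1r -natrX -natr_sum ler_nat.
  rewrite -big_mkcond/= sum1_count -size_filter.
  rewrite -[X in (_ <= X)%N](size_iota (k * 4 ^ j)); apply: uniq_leq_size.
    by rewrite filter_uniq ?iota_uniq.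
  move=> x; rewrite mem_filter mem_iota => /andP[/eqP <- _].
  by rewrite leq_divM -[X in (_ < X + _)%N]mulnC -mulnSr mulnC ltn_ceil.
have [j0 /existsP[x0 /andP[x0m /eqP x0k]]|none] := pickP (fun j : 'I_m.+2 =>
    [exists x : 'I_(4 ^ m.+1), (4 ^ m <= x)%N && ((x %/ 4 ^ j)%N == k)]); last first.
  rewrite big1 ?ler01// => j _; rewrite big_nat big1// => x /andP[x1 x2].
  have := none j; move=> /existsPn/(_ (Ordinal x2))/=; rewrite x1/= => /negbTE ->.
  by rewrite mul0r.
rewrite (bigD1 j0)//= [X in _ + X]big1 ?addr0 ?term// => j jj0.
rewrite big_nat big1// => x /andP[x1 x2].
case: eqP => [xk|_]; last by rewrite mul0r.
have scale_lt (y z i i' : nat) : (4 ^ m <= y)%N -> (z < 4 ^ m.+1)%N -> (i < i')%N ->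
    (y %/ 4 ^ i)%N = k -> (z %/ 4 ^ i')%N = k -> (i' <= m.+1)%N -> False.
  move=> ym zm ii' yk zk i'm.
  have : (k < 4 ^ (m.+1 - i'))%N.
    by rewrite -zk ltn_divLR// -expnD subnK.
  have : (4 ^ (m - i) <= k)%N.
    by rewrite -yk leq_divRL// -expnD subnK//; lia.
  move=> /leq_ltn_trans/[apply]; rewrite ltn_exp2l//; lia.
have [ltj|gtj|eqj] := ltngtP j j0.
- by case: (scale_lt x x0 j j0); rewrite // -ltnS.
- by case: (scale_lt x0 x j0 j); rewrite // -ltnS.
- by move/val_inj : eqj jj0 => ->; rewrite eqxx.
Qed.

(** Summing [count_scales] over the radii between [a] and [b]: this is the
    discrete form of the fact that the density 1 / x gives weight dr to r
    times the event that some level has radius in dr. *)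
Lemma count_cut_scales (F : realFieldType) (m a b : nat) : (a <= b)%N ->
  \sum_(4 ^ m <= x < 4 ^ m.+1) \sum_(j < m.+2)
    (a * 4 ^ j <= x < b * 4 ^ j)%N%:R / 4 ^+ j <= (b - a)%:R :> F.
Proof.
move=> ab.
have pw j : (0 < 4 ^ j)%N by rewrite expn_gt0.
have split_cut x j : (a * 4 ^ j <= x < b * 4 ^ j)%N%:R / 4 ^+ j =
    \sum_(a <= k < b) ((x %/ 4 ^ j)%N == k)%:R / 4 ^+ j :> F.
  rewrite -big_distrl/= -natr_sum; congr (_%:R / _).
  rewrite -leq_divRL// -ltn_divLR//; set q := (x %/ 4 ^ j)%N.
  rewrite -big_mkcond/= (eq_bigl (pred1 q)); last by move=> k; rewrite /= eq_sym.
  rewrite sum1_count count_uniq_mem ?iota_uniq// mem_iota.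
  by rewrite subnKC.
under eq_bigr do under eq_bigr do rewrite split_cut.
under eq_bigr do rewrite exchange_big/=.
rewrite exchange_big/=.
apply: (@le_trans _ _ (\sum_(a <= k < b) 1)).
  by apply: ler_sum => k _; exact: count_scales.
by rewrite sumr_const_nat.
Qed.

Section random_centers.
Variables (A : finType) (N : A -> A -> nat).
Hypothesis Nuu : forall u, N u u = 0%N.
Hypothesis Nsym : forall u v, N u v = N v u.
Hypothesis Ntri : forall u v w, (N u w <= N u v + N v w)%N.

(** The ball around [u] has radius x / 4 ^ j; the factor [4 ^ j] on the
    left keeps the comparison in the naturals. *)
Definition cluster_center (s : {perm A}) (x j : nat) (u : A) : A :=
  [arg min_(w < u | (N u w * 4 ^ j <= x)%N) prio s w].

Lemma cluster_centerP s x j u : (N u (cluster_center s x j u) * 4 ^ j <= x)%N /\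
  forall w, (N u w * 4 ^ j <= x)%N -> (prio s (cluster_center s x j u) <= prio s w)%N.
Proof. by rewrite /cluster_center; case: arg_minnP => //; rewrite Nuu. Qed.

Lemma cluster_center_unique s x j u w : (N u w * 4 ^ j <= x)%N ->
  (forall w', (N u w' * 4 ^ j <= x)%N -> (prio s w <= prio s w')%N) ->
  cluster_center s x j u = w.
Proof.
move=> uw wmin; have [cu cmin] := cluster_centerP s x j u.
by apply: (@prio_inj _ s); apply/eqP; rewrite eqn_leq cmin//= wmin.
Qed.

Let near u v w := minn (N u w) (N v w).
Let far u v w := maxn (N u w) (N v w).

Lemma near_far u v w : (far u v w - near u v w <= N u v)%N.
Proof.
rewrite /far /near; have := Ntri u v w; have := Ntri v u w; rewrite (Nsym v u); lia.
Qed.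

(** The first point [w] of the order in the union of the two balls of
    radius x / 4 ^ j is the center of each of [u], [v] whose ball contains
    it. When the centers differ, [w] lies in one ball only, and it
    precedes every point that is nearer to the pair, as such a point is in
    the union. *)
Lemma centers_differ s x j u v : cluster_center s x j u != cluster_center s x j v ->
  exists w, (near u v w * 4 ^ j <= x < far u v w * 4 ^ j)%N /\
    s \in first_perms [set w' | near u v w' <= near u v w]%N w.
Proof.
move=> ne.
pose w := [arg min_(w < u | (near u v w * 4 ^ j <= x)%N) prio s w].
have [wx wmin] : (near u v w * 4 ^ j <= x)%N /\
    forall w', (near u v w' * 4 ^ j <= x)%N -> (prio s w <= prio s w')%N.
  by rewrite /w; case: arg_minnP => //; rewrite /near Nuu min0n.
have near_or w' : (near u v w' * 4 ^ j <= x)%N =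
    (N u w' * 4 ^ j <= x)%N || (N v w' * 4 ^ j <= x)%N.
  by rewrite /near minnMl geq_min.
exists w; split.
  rewrite wx /= ltnNge; apply/negP; rewrite /far maxnMl geq_max => /andP[ux vx].
  move/eqP: ne; apply; transitivity w; last symmetry; apply: cluster_center_unique => //.
    by move=> w' uw'; apply: wmin; rewrite near_or uw'.
  by move=> w' vw'; apply: wmin; rewrite near_or vw' orbT.
rewrite inE; apply/forall_inP => w'; rewrite inE => w'w.
by apply: wmin; apply: leq_trans wx; rewrite leq_mul2r w'w orbT.
Qed.

(** The distortion estimate for the random centers: the expectation over
    [s] and [x], up to normalization, of the sum of the radii at which [u]
    and [v] have different centers. The weight 1 / x of the scale has been
    cancelled against the numerator of the radius x / 4 ^ j. *)
Theorem expected_cut_scales (F : realFieldType) (m : nat) (u v : A) :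
  \sum_(s : {perm A}) \sum_(4 ^ m <= x < 4 ^ m.+1) \sum_(j < m.+2)
    (cluster_center s x j u != cluster_center s x j v)%:R / 4 ^+ j <=
  #|{perm A}|%:R * (\sum_(k < #|A|) k.+1%:R^-1) * (N u v)%:R :> F.
Proof.
pose cut x j w : F := (near u v w * 4 ^ j <= x < far u v w * 4 ^ j)%N%:R / 4 ^+ j.
pose S w := [set w' | near u v w' <= near u v w]%N.
have cut_ge0 x j w : 0 <= cut x j w by rewrite divr_ge0// exprn_ge0.
apply: (@le_trans _ _ (\sum_(s : {perm A}) \sum_(4 ^ m <= x < 4 ^ m.+1)
    \sum_(j < m.+2) \sum_w (s \in first_perms (S w) w)%:R * cut x j w)).
  apply: ler_sum => s _; apply: ler_sum => x _; apply: ler_sum => j _.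
  have [_|ne] := eqVneq; first by rewrite mul0r sumr_ge0// => w _; rewrite mulr_ge0.
  have [w [wc ws]] := centers_differ ne.
  have -> : true%:R / 4 ^+ j = (s \in first_perms (S w) w)%:R * cut x j w :> F.
    by rewrite ws /cut wc [RHS]mul1r.
  rewrite [leRHS](bigD1 w)//= lerDl sumr_ge0// => w' _.
  by rewrite mulr_ge0// cut_ge0.
have -> : \sum_(s : {perm A}) \sum_(4 ^ m <= x < 4 ^ m.+1)
    \sum_(j < m.+2) \sum_w (s \in first_perms (S w) w)%:R * cut x j w =
    \sum_w #|first_perms (S w) w|%:R *
      \sum_(4 ^ m <= x < 4 ^ m.+1) \sum_(j < m.+2) cut x j w.
  under eq_bigr do under eq_bigr do rewrite exchange_big/=.
  under eq_bigr do rewrite exchange_big/=.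
  rewrite exchange_big/=; apply: eq_bigr => w _.
  rewrite -sum1_card natr_sum big_distrl/= [RHS]big_mkcond/=; apply: eq_bigr => s _.
  case: ifP => _.
    rewrite mul1r; apply: eq_bigr => x _; apply: eq_bigr => j _.
    by rewrite mul1r.
  by rewrite big1// => x _; rewrite big1// => j _; rewrite mul0r.
apply: (@le_trans _ _ (\sum_w #|{perm A}|%:R / #|S w|%:R * (N u v)%:R)).
  apply: ler_sum => w _; apply: ler_pM => //.
  - by apply: sumr_ge0 => x _; apply: sumr_ge0.
  - have wS : w \in S w by rewrite inE.
    rewrite ler_pdivlMr ?ltr0n ?finset.card_gt0; last by apply/finset.set0Pn; exists w.
    by rewrite -natrM ler_nat mulnC card_first_perms.
  - apply: le_trans (count_cut_scales _ _ _) _.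
      by rewrite geq_min leq_max leqnn.
    by rewrite ler_nat near_far.
rewrite -big_distrl -big_distrr/= ler_wpM2r// ler_wpM2l//.
exact: sum_inv_rank.
Qed.

End random_centers.

Local Open Scope classical_set_scope.
Local Open Scope ring_scope.

(** * Harmonic sums *)

Section harmonic.
Variable R : realType.

Lemma ln_ratio_ge (x : R) : 0 < x -> (x + 1)^-1 <= ln (x + 1) - ln x.
Proof.
move=> x0; have x10 : 0 < x + 1 by rewrite addr_gt0.
rewrite -ln_div// -[leLHS]opprK lerNl -lnV ?posrE ?divr_gt0// invf_div.
have -> : x / (x + 1) = 1 + - (x + 1)^-1 by field; rewrite gt_eqF.
by rewrite le_ln1Dx// ltrN2 invf_lt1// ltrDr.
Qed.

Lemma ln_ratio_le (x : R) : 0 < x -> ln (x + 1) - ln x <= x^-1.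
Proof.
move=> x0; have x10 : 0 < x + 1 by rewrite addr_gt0.
rewrite -ln_div//.
have -> : (x + 1) / x = 1 + x^-1 by field; rewrite gt_eqF.
by rewrite le_ln1Dx// (lt_trans _ (_ : 0 < _)) ?invr_gt0// ltrN10.
Qed.

(** ln 2 is at least 1/9 + ... + 1/16. *)
Lemma ln2_ge : 6628 / 10000 <= ln 2 :> R.
Proof.
have -> : ln 2 = \sum_(8 <= k < 16) (ln (k%:R + 1) - ln k%:R) :> R.
  under eq_bigr do rewrite natr1.
  by rewrite telescope_sumr// -ln_div ?posrE ?ltr0n//; congr ln; lra.
apply: (@le_trans _ _ (\sum_(8 <= k < 16) (k%:R + 1)^-1)).
  rewrite 8?big_nat_recl// big_geq//= !natr1 addr0; lra.
by rewrite big_nat [leRHS]big_nat ler_sum// => k /andP[k8 _]; rewrite ln_ratio_ge// ltr0n; lia.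
Qed.

Lemma harmonic_scales_ge m :
  2 * ln 2 <= \sum_(4 ^ m <= x < 4 ^ m.+1) x%:R^-1 :> R.
Proof.
have -> : 2 * ln 2 = ln (4 ^ m.+1)%:R - ln (4 ^ m)%:R :> R.
  by rewrite !natrX !lnXn// -mulrnBr// subSnn mulr1n (_ : 4 = 2 ^+ 2) ?lnXn// -?natrX// mulr_natl.
rewrite -(@telescope_sumr _ _ _ (fun k => ln k%:R)) ?leq_exp2l//.
rewrite big_nat [leRHS]big_nat ler_sum// => k /andP[k4 _].
by rewrite -natr1 ln_ratio_le// ltr0n (leq_trans _ k4)// expn_gt0.
Qed.

(** There is equality for [n = 2], and each further term 1 / n is at most
    ln n - ln (n - 1), while 3 / (2 ln 2) exceeds 1. *)
Lemma harmonic_le_log2 n : (1 < n)%N ->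
  \sum_(k < n) k.+1%:R^-1 <= 3 / 2 * (ln n%:R / ln 2) :> R.
Proof.
have ln2 := ln2_ge.
elim: n => // -[//|[_ _|n IH _]].
  rewrite !big_ord_recr big_ord0/= divff; last by lra.
  lra.
rewrite big_ord_recr/=.
have := @ln_ratio_ge n.+2%:R; rewrite natr1 ltr0n => /(_ isT) h.
have le1 : ln 2 <= 1 :> R.
  by have := @ln_ratio_le 1 ltr01; rewrite ln1 subr0 invr1.
have ln2_gt0 : 0 < ln 2 :> R by lra.
have d0 : 0 <= ln n.+3%:R - ln n.+2%:R :> R by apply: le_trans h; rewrite invr_ge0 ler0n.
apply: (@le_trans _ _ (3 / 2 * (ln n.+2%:R / ln 2) +
    3 / 2 * ((ln n.+3%:R - ln n.+2%:R) / ln 2))).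
  apply: lerD; first exact: IH.
  apply: (le_trans h); rewrite mulrA ler_pdivlMr//.
  by rewrite mulrC ler_wpM2r//; lra.
by rewrite -mulrDr -mulrDl (addrC (ln n.+2%:R)) subrK.
Qed.

(** The constant is 10 / (ln 2) ^ 2, which is below 22.9 because ln 2 >
    0.6628. *)
Lemma distortion_lt n m : (1 < n)%N ->
  40 / 3 * (\sum_(k < n) k.+1%:R^-1) / (\sum_(4 ^ m <= x < 4 ^ m.+1) x%:R^-1)
    <= 229 / 10 * ln n%:R :> R.
Proof.
move=> n1; have ln2 := ln2_ge; have ln2_gt0 : 0 < ln 2 :> R by lra.
have Z := harmonic_scales_ge m; have H := harmonic_le_log2 n1.
have lnn : 0 <= ln n%:R :> R by rewrite ln_ge0// ler1n ltnW.
rewrite ler_pdivrMr; last by apply: lt_le_trans Z; rewrite mulr_gt0.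
apply: le_trans (_ : 40 / 3 * (3 / 2 * (ln n%:R / ln 2)) <= _).
  by rewrite ler_wpM2l.
apply: le_trans (_ : 229 / 10 * ln n%:R * (2 * ln 2) <= _); last first.
  by rewrite ler_wpM2l// mulr_ge0.
have -> : 40 / 3 * (3 / 2 * (ln n%:R / ln 2)) = 20 * ln n%:R / ln 2 :> R.
  by field; rewrite gt_eqF.
rewrite ler_pdivrMr//.
have : 20 <= 229 / 10 * 2 * (ln 2 * ln 2) :> R by nra.
nra.
Qed.

End harmonic.

(** * Maps with countably many values *)

Section countable_valued.
Context d (T : measurableType d) (R : realType).
Local Open Scope ereal_scope.

Lemma measurable_fun_nat (D : set T) (f : T -> nat) :
  (forall k, measurable (D `&` f @^-1` [set k])) -> measurable_fun D f.
Proof.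
move=> mf _ Q _.
have -> : D `&` f @^-1` Q = \bigcup_(k in Q) (D `&` f @^-1` [set k]).
  apply/seteqP; split=> [t [Dt Qt]|t [k Qk [Dt /= ->]]]; last by split.
  by exists (f t).
by apply: bigcup_measurable => k _.
Qed.

Lemma measurable_nat_comp d' (U : sigmaRingType d') (D : set T) (f : T -> nat) (g : nat -> U) :
  measurable_fun D f -> measurable_fun D (g \o f).
Proof. by move=> mf mD Q _; rewrite comp_preimage; apply: mf. Qed.

(** This holds for arbitrary functions, because the integral of a
    nonnegative function is the supremum of the integrals of the simple
    functions below it. *)
Lemma integral_mono (mu : {measure set T -> \bar R}) (D : set T) (f g : T -> \bar R) :
  (forall t, D t -> 0 <= f t) -> (forall t, D t -> f t <= g t) ->
  \int[mu]_(t in D) f t <= \int[mu]_(t in D) g t.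
Proof.
move=> f0 fg; rewrite (integral_mkcond D f) (integral_mkcond D g).
have fD0 t : 0 <= (f \_ D) t by rewrite patchE; case: ifPn => // /set_mem/f0.
have fgD t : (f \_ D) t <= (g \_ D) t.
  by rewrite !patchE; case: ifPn => // /set_mem/fg.
have gD0 t : 0 <= (g \_ D) t := le_trans (fD0 t) (fgD t).
rewrite !ge0_integralTE//; apply: ub_ereal_sup => _ [h hf <-].
by apply: ereal_sup_ubound; exists h => // t; exact: le_trans (hf t) (fgD t).
Qed.

Lemma integral_nat_valued (mu : {measure set T -> \bar R}) (D : set T) (f : T -> nat)
    (h : nat -> \bar R) : measurable D -> measurable_fun D f -> (forall k, 0 <= h k) ->
  \int[mu]_(t in D) h (f t) = \sum_(k <oo) h k * mu (D `&` f @^-1` [set k]).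
Proof.
move=> mD mf h0.
have mDk k : measurable (D `&` f @^-1` [set k]) by exact: mf.
have DE : D = \bigcup_k (D `&` f @^-1` [set k]).
  by apply/seteqP; split=> [t Dt|t [k _ []]//]; exists (f t).
rewrite [in LHS]DE ge0_integral_bigcup//=.
- apply: eq_eseriesr => k _; rewrite -integral_cst//.
  by apply: eq_integral => t /set_mem[_ /= ->].
- rewrite -DE; exact: measurable_nat_comp.
- exact: trivIset_preimage1_in.
Qed.

Lemma law_nat (mu : {measure set T -> \bar R}) (D : set T) (f : T -> nat) (Q : set nat) :
  measurable D -> measurable_fun D f ->
  mu (D `&` f @^-1` Q) = \sum_(k <oo | k \in Q) mu (D `&` f @^-1` [set k]).
Proof.
move=> mD mf; rewrite -measure_bigcup//.
- congr (mu _); apply/seteqP; split=> [t [Dt Qt]|t [k Qk [Dt /= ->]]]; last by split.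
  by exists (f t).
- by move=> k _; exact: mf.
- exact: trivIset_preimage1_in.
Qed.

End countable_valued.

(** Two countably valued maps have the same law as soon as they take each
    value with the same probability; the values are transported to the
    naturals by [pickle]. *)
Lemma law_countable_ext d1 d2 (T1 : measurableType d1) (T2 : measurableType d2)
    (R : realType) (mu1 : {measure set T1 -> \bar R}) (mu2 : {measure set T2 -> \bar R})
    (K : countType) (D1 : set T1) (D2 : set T2) (f1 : T1 -> K) (f2 : T2 -> K) (Q : set K) :
  measurable D1 -> measurable D2 ->
  (forall k, measurable (D1 `&` f1 @^-1` [set k])) ->
  (forall k, measurable (D2 `&` f2 @^-1` [set k])) ->
  (forall k, mu1 (D1 `&` f1 @^-1` [set k]) = mu2 (D2 `&` f2 @^-1` [set k])) ->
  [/\ measurable (D1 `&` f1 @^-1` Q), measurable (D2 `&` f2 @^-1` Q) &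
      mu1 (D1 `&` f1 @^-1` Q) = mu2 (D2 `&` f2 @^-1` Q)].
Proof.
move=> mD1 mD2 mf1 mf2 f12.
have code T (D : set T) (f : T -> K) k : D `&` (pickle \o f) @^-1` [set k] =
    if pickle_inv k is Some z then D `&` f @^-1` [set z] else set0.
  case E : (pickle_inv k) => [z|]; apply/seteqP; split=> t //.
  - by case=> Dt /= fk; split => //=; move: E; rewrite -fk pickleK_inv => -[].
  - case=> Dt /= ->; split => //=.
    by have := @pickle_invK K k; rewrite /ocancel E.
  - by case=> Dt /= fk; move: E; rewrite -fk pickleK_inv.
have QE T (D : set T) (f : T -> K) : D `&` f @^-1` Q = D `&` (pickle \o f) @^-1` (pickle @` Q).
  apply/seteqP; split=> t [Dt /= Qt]; split => //=; first by exists (f t).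
  by case: Qt => z Qz /(pcan_inj pickleK) <-.
have m1 : measurable_fun D1 (pickle \o f1).
  by apply: measurable_fun_nat => k; rewrite code; case: pickle_inv.
have m2 : measurable_fun D2 (pickle \o f2).
  by apply: measurable_fun_nat => k; rewrite code; case: pickle_inv.
rewrite !QE; split; [exact: m1|exact: m2|].
rewrite !law_nat//; apply: eq_eseriesr => k _; rewrite !code.
by case: pickle_inv => // *; rewrite !measure0.
Qed.

(** * Cutting an interval into slots of prescribed lengths *)

Section slots.
Context {R : realType}.
Implicit Types (a m t : R) (p : nat -> R) (k : nat).

Definition slot_start a p k : R := a + \sum_(i < k) p i.

Definition slot a p k : set R := `[slot_start a p k, slot_start a p k.+1[%classic.

Definition slot_index a p t : nat := xget 0%N [set k | slot a p k t].

Lemma slot_startS a p k : slot_start a p k.+1 = slot_start a p k + p k.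
Proof. by rewrite /slot_start big_ord_recr addrA. Qed.

Lemma measurable_slot a p k : measurable (slot a p k).
Proof. exact: measurable_itv. Qed.

Lemma lebesgue_itvco (b w : R) : 0 <= w -> lebesgue_measure `[b, b + w[ = w%:E.
Proof.
move=> w0; rewrite lebesgue_measure_itv/= lte_fin.
have [_|] := ltP; first by rewrite -EFinD addrAC subrr add0r.
by rewrite gerDl => wle0; congr EFin; apply/eqP; rewrite eq_le w0 wle0.
Qed.

Section nonneg_weights.
Variables (a m : R) (p : nat -> R).
Hypothesis p0 : forall k, 0 <= p k.

Lemma slot_start_homo k l : (k <= l)%N -> slot_start a p k <= slot_start a p l.
Proof.
move=> kl; rewrite lerD2l -!(big_mkord predT) [leRHS](big_cat_nat (n := k))//= lerDl.
exact: sumr_ge0.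
Qed.

Lemma lebesgue_slot k : lebesgue_measure (slot a p k) = (p k)%:E.
Proof. by rewrite /slot slot_startS lebesgue_itvco. Qed.

Lemma slot_inj t k l : slot a p k t -> slot a p l t -> k = l.
Proof.
suff H i j : (i < j)%N -> slot a p i t -> slot a p j t -> False.
  move=> kt lt; case: (ltngtP k l) => // h; last by case: (H _ _ h lt kt).
  by case: (H _ _ h kt lt).
move=> ij; rewrite /slot/= !in_itv/= => /andP[_ ti] /andP[jt _].
by have := le_lt_trans (le_trans (slot_start_homo ij) jt) ti; rewrite ltxx.
Qed.

Lemma slot_indexE t k : slot a p k t -> slot_index a p t = k.
Proof.
move=> kt; apply: (@slot_inj t) => //; rewrite /slot_index.
exact: (@xgetPex _ 0%N [set k | slot a p k t] (ex_intro _ k kt)).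
Qed.

Hypothesis pm : (\sum_(k <oo) (p k)%:E = m%:E)%E.

(** The endpoint [a + m] is the limit of the starts of the slots, so a
    point before it precedes the start of some slot; the slot before the
    first such one contains it. *)
Lemma slot_cover : `[a, a + m[%classic = \bigcup_k slot a p k.
Proof.
have sumE n : (\sum_(0 <= k < n) (p k)%:E)%E = (\sum_(i < n) p i)%:E.
  by rewrite big_mkord sumEFin.
have sum_le n : \sum_(i < n) p i <= m.
  rewrite -lee_fin -pm -sumE; apply: nneseries_lim_ge => k _ _.
  by rewrite lee_fin.
apply/seteqP; split=> [t|t [k _]]; rewrite /slot/= !in_itv/= => /andP[t1 t2].
  have /ex_minnP[[|n]] : exists n, t < slot_start a p n.
  - apply: contrapT => /forallNP H.
    suff : (m%:E <= (t - a)%:E)%E by rewrite lee_fin lerBrDl leNgt t2.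
    rewrite -pm; apply: lime_le.
      by apply: is_cvg_nneseries => k _ _; rewrite lee_fin.
    apply: nearW => n; rewrite sumE lee_fin lerBrDl leNgt.
    exact/negP/H.
  - by rewrite /slot_start big_ord0 addr0 ltNge t1.
  move=> tn nmin; exists n => //; rewrite /slot/= in_itv/= tn andbT leNgt.
  by apply/negP => /nmin; rewrite ltnn.
apply/andP; split.
  by apply: le_trans t1; rewrite /slot_start lerDl sumr_ge0.
by apply: lt_le_trans t2 _; rewrite lerD2l.
Qed.

Lemma slot_index_preimage k :
  `[a, a + m[ `&` slot_index a p @^-1` [set k] = slot a p k.
Proof.
rewrite slot_cover; apply/seteqP; split=> [t [[l _ lt] /= <-]|t kt].
  by rewrite (slot_indexE lt).
by split; [exists k|exact: slot_indexE].
Qed.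

Lemma measurable_slot_index : measurable_fun `[a, a + m[ (slot_index a p).
Proof.
by apply: measurable_fun_nat => k; rewrite slot_index_preimage; exact: measurable_slot.
Qed.

End nonneg_weights.
End slots.

(** * Borel measures and closed sets *)

Lemma image_measure d1 d2 (T1 : measurableType d1) (T2 : measurableType d2)
    (R : realType) (mu : {measure set T1 -> \bar R}) (D : set T1) (f : T1 -> T2) :
  measurable D -> measurable_fun D f ->
  exists rho : {measure set T2 -> \bar R}, forall B, rho B = mu (D `&` f @^-1` B).
Proof.
move=> mD mf; pose rho (B : set T2) := mu (D `&` f @^-1` B).
have rho0 : rho set0 = 0 by rewrite /rho preimage_set0 setI0 measure0.
have rho_ge0 B : (0 <= rho B)%E by exact: measure_ge0.
have rho_add : semi_sigma_additive rho.
  move=> F mF tF mUF; rewrite /rho preimage_bigcup setI_bigcupr.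
  apply: measure_semi_sigma_additive.
  - by move=> n; exact: mf.
  - apply/trivIsetP => i j _ _ ij; apply/seteqP; split => // t [[_ ti] [_ tj]].
    by have /trivIsetP/(_ i j I I ij)/seteqP[/(_ (f t)) FF _] := tF; apply: FF.
  - by rewrite -setI_bigcupr -preimage_bigcup; exact: mf.
pose rho_mixin := isMeasure.Build _ _ _ rho rho0 rho_ge0 rho_add.
by pose rho_pack : {measure set T2 -> \bar R} := HB.pack rho rho_mixin; exists rho_pack.
Qed.

Section borel_metric.
Context {R : realType} {X : completeMetricType R}.
Implicit Types (F : set X) (e : R).

Lemma open_borel (U : set X) : open U -> measurable (U : set (borel X)).
Proof. exact: sub_sigma_algebra. Qed.

Lemma closed_borel F : closed F -> measurable (F : set (borel X)).
Proof.
move=> cF; rewrite -[F]setCK; apply: (@measurableC _ (borel X)).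
by apply: open_borel; exact: closed_openC.
Qed.

Definition enlarge F e : set X := [set y | exists2 x, F x & mdist x y < e].

Lemma open_mdist_lt (x : X) e : open [set y | mdist x y < e].
Proof.
rewrite openE => y /= xy; apply/nbhs_ballP; exists (e - mdist x y) => /=.
  by rewrite subr_gt0.
move=> z; rewrite ballEmdist/= => yz.
by apply: le_lt_trans (metric_triangle x y z) _; rewrite -ltrBrDl.
Qed.

Lemma open_enlarge F e : open (enlarge F e).
Proof.
have -> : enlarge F e = \bigcup_(x in F) [set y | mdist x y < e].
  by apply/seteqP; split=> y [x Fx xy]; exists x.
by apply: bigcup_open => x _; exact: open_mdist_lt.
Qed.

Lemma measurable_enlarge F e : measurable (enlarge F e : set (borel X)).
Proof. apply: open_borel; exact: open_enlarge. Qed.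

Lemma sub_enlarge F e : 0 < e -> F `<=` enlarge F e.
Proof. by move=> e0 x Fx; exists x => //; rewrite mdistxx. Qed.

Lemma enlarge_mdist F e1 e2 (x y : X) :
  enlarge F e1 x -> mdist x y < e2 -> enlarge F (e1 + e2) y.
Proof.
move=> [z Fz zx] xy; exists z => //.
by apply: le_lt_trans (metric_triangle z x y) _; rewrite ltrD.
Qed.

Lemma enlarge_subset F e1 e2 : e1 <= e2 -> enlarge F e1 `<=` enlarge F e2.
Proof. by move=> e12 y [x Fx xy]; exists x => //; exact: lt_le_trans xy e12. Qed.

Lemma closed_enlarge F (e : nat -> R) : closed F ->
  (forall d, 0 < d -> exists n, e n <= d) -> \bigcap_n enlarge F (e n) `<=` F.
Proof.
move=> cF e_small x Fx; apply: cF => B /nbhs_ballP[d /= d0 dB].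
have [n nd] := e_small d d0; have [y Fy yx] := Fx n I.
exists y; split => //; apply: dB; rewrite ballEmdist/= metric_sym.
exact: lt_le_trans yx nd.
Qed.

Lemma natSinv_small (d : R) : 0 < d -> exists n, n.+1%:R^-1 <= d :> R.
Proof.
move=> d0; exists (Num.truncn d^-1); rewrite -[leRHS]invrK lef_pV2 ?posrE ?invr_gt0//.
by rewrite ltW// truncnS_gt.
Qed.

(** A closed set is the intersection of its open enlargements, and [mu2]
    is continuous along this decreasing sequence. *)
Lemma le_measure_closed d (T : measurableType d) (mu1 : {measure set T -> \bar R}) (A : set T)
    (mu2 : {measure set (borel X) -> \bar R}) F :
  closed F -> (mu2 setT < +oo)%E ->
  (forall e, 0 < e -> (mu1 A <= mu2 (enlarge F e))%E) -> (mu1 A <= mu2 F)%E.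
Proof.
move=> cF fin h.
have FE : F = \bigcap_n enlarge F n.+1%:R^-1.
  apply/seteqP; split=> [x Fx n _|]; last first.
    by apply: closed_enlarge => // d' /natSinv_small.
  by apply: sub_enlarge => //; rewrite invr_gt0 ltr0n.
pose Fn n := enlarge F n.+1%:R^-1.
have cv : (mu2 \o Fn) n @[n --> \oo] --> mu2 (\bigcap_n Fn n).
  apply: nonincreasing_cvg_mu.
  - apply: le_lt_trans fin; apply: le_measure; rewrite ?inE//.
    exact: measurable_enlarge.
  - by move=> n; exact: measurable_enlarge.
  - by rewrite -FE; exact: closed_borel.
  - move=> n k nk; apply/subsetPset/enlarge_subset.
    by rewrite lef_pV2 ?posrE ?ltr0n// ler_nat.
rewrite FE -(cvg_lim _ cv)//; apply: lime_ge; first by apply: cvgP cv.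
by apply: nearW => n /=; apply: h; rewrite invr_gt0 ltr0n.
Qed.

(** Complements of closed sets are open sets, which generate the Borel
    sets and are stable under intersection. *)
Lemma eq_measure_closed (mu1 mu2 : {measure set (borel X) -> \bar R}) :
  (mu1 setT < +oo)%E ->
  (forall F, closed F -> mu1 F = mu2 F) ->
  forall B, measurable B -> mu1 B = mu2 B.
Proof.
move=> fin1 h.
have fin2 : (mu2 setT < +oo)%E by rewrite -h//; exact: closedT.
apply: (@measure_unique _ R (borel X) (@open X) (fun=> setT)) => //.
- by move=> U V; exact: openI.
- by move=> _; exact: openT.
- by rewrite bigcup_const.
- move=> U oU; have cU : closed (~` U) by exact: open_closedC.
  have mC := closed_borel cU.
  have UE : U = setT `\` (~` U) by rewrite setTD setCK.
  rewrite UE [LHS]measureD// [RHS]measureD// !setTI; congr (_ - _)%E; apply: h => //.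
Qed.

End borel_metric.

(** * A finite Borel measure as the image of an interval *)

Lemma separable_dense_seq (R : realType) (X : completeMetricType R) : separable X ->
  exists s : nat -> X, forall x e, 0 < e -> exists i, mdist (s i) x < e.
Proof.
move=> [D /pfcard_geP[D0|/unsquash f] dD].
  have [x [_]] := dD setT (ex_intro _ point I) openT.
  by rewrite D0.
exists f => x e e0.
have [|y [xy Dy]] := dD [set y | mdist x y < e] _ (open_mdist_lt x e).
  by exists x; rewrite /= mdistxx.
have [i _ fi] := @surj _ _ _ _ f y Dy.
by exists i; rewrite fi metric_sym.
Qed.

Section cells.
Context {R : realType} {X : completeMetricType R}.
Variable s : nat -> X.
Hypothesis s_dense : forall x e, 0 < e -> exists i, mdist (s i) x < e.

(** Cells at radius [e]: [x] goes to the first point of the dense sequence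
    within [e] of it. This is a countable partition of the space into
    Borel sets of diameter at most [2 * e]. *)
Definition cell (e : R) (x : X) : nat :=
  xget 0%N [set i | mdist (s i) x < e /\ forall j, (j < i)%N -> ~ mdist (s j) x < e].

Lemma cellP e x : 0 < e ->
  mdist (s (cell e x)) x < e /\ forall j, (j < cell e x)%N -> ~ mdist (s j) x < e.
Proof.
move=> e0; rewrite /cell; case: xgetP => [i _ //|none]; exfalso.
have /ex_minnP[i xi imin] := s_dense x e0.
by apply: (none i); split => // j ji /imin; rewrite leqNgt ji.
Qed.

Lemma measurable_cell e i : 0 < e -> measurable (cell e @^-1` [set i] : set (borel X)).
Proof.
move=> e0.
have -> : cell e @^-1` [set i] =
    [set x | mdist (s i) x < e] `\` \bigcup_(j in `I_i) [set x | mdist (s j) x < e].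
  apply/seteqP; split=> [x /= <-|x [/= xi xmin]].
    by have [] := cellP x e0; split => // -[j /= ji]; exact: b.
  have [xc cmin] := cellP x e0.
  have [ltc|gtc|//] := ltngtP (cell e x) i.
    by exfalso; apply: xmin; exists (cell e x).
  by case: (cmin i gtc).
apply: measurableD; first by apply: open_borel; exact: open_mdist_lt.
by apply: bigcup_measurable => j _; apply: open_borel; exact: open_mdist_lt.
Qed.

End cells.

Section realization.
Context {R : realType} {X : completeMetricType R}.
Variables (nu : {measure set (borel X) -> \bar R}) (a : R).
Hypothesis nu_fin : (nu setT < +oo)%E.
Variable s : nat -> X.
Hypothesis s_dense : forall x e, 0 < e -> exists i, mdist (s i) x < e.

Let r n : R := (2 ^+ n)^-1.

Let r_gt0 n : 0 < r n. Proof. by rewrite invr_gt0 exprn_gt0. Qed.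

Let r_homo k n : (k <= n)%N -> r n <= r k.
Proof. by move=> kn; rewrite lef_pV2 ?posrE ?exprn_gt0// ler_weXn2l// ler1n. Qed.

Let r_small e : 0 < e -> exists n, r n <= e.
Proof.
move=> /natSinv_small[n ne]; exists n; apply: le_trans ne.
by rewrite lef_pV2 ?posrE ?exprn_gt0 ?ltr0n// -natrX ler_nat ltn_expl.
Qed.

(** The cells of [x] at the radii 1, 1/2, 1/4, ..., the last one at the
    head. *)
Fixpoint itinerary n (x : X) : seq nat :=
  if n is n'.+1 then cell s (r n') x :: itinerary n' x else [::].

Let branch (u : seq nat) : set (borel X) := itinerary (size u) @^-1` [set u].

Let mass u : R := fine (nu (branch u)).

Let size_itinerary n x : size (itinerary n x) = n.
Proof. by elim: n => //= n ->. Qed.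

Let branch_cons i u : branch (i :: u) = branch u `&` cell s (r (size u)) @^-1` [set i].
Proof.
by apply/seteqP; split=> x /=; rewrite /branch /=; [case=> -> -> | case=> -> ->].
Qed.

Let measurable_branch u : measurable (branch u).
Proof.
elim: u => [|i u IH].
  by rewrite (_ : branch [::] = setT)//; apply/seteqP; split.
by rewrite branch_cons; apply: measurableI => //; exact: measurable_cell.
Qed.

Let nu_branch u : nu (branch u) = (mass u)%:E.
Proof.
rewrite fineK// ge0_fin_numE//; apply: le_lt_trans nu_fin.
by apply: le_measure; rewrite ?inE.
Qed.

Let mass_ge0 u : 0 <= mass u.
Proof. by rewrite -lee_fin -nu_branch. Qed.

Let mass_children u : (\sum_(i <oo) (mass (i :: u))%:E = (mass u)%:E)%E.
Proof.
have -> : (mass u)%:E = nu (\bigcup_i branch (i :: u)).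
  rewrite -nu_branch; congr (nu _); apply/seteqP; split=> [x xu|x [i _]].
    by exists (cell s (r (size u)) x) => //; rewrite branch_cons; split.
  by rewrite branch_cons => -[].
rewrite measure_bigcup//.
- rewrite [RHS](@eq_eseriesl _ _ xpredT); last by move=> i; rewrite in_setT.
  by apply: eq_eseriesr => i _; rewrite nu_branch.
- apply/trivIsetP => i j _ _ ij; apply/seteqP; split=> // x [].
  by rewrite !branch_cons => -[_ /= xi] [_ /= xj]; move: ij; rewrite -xi -xj eqxx.
Qed.

(** The interval of length [nu setT] that starts at [a] is cut according
    to the first cell into slots whose lengths are the masses of these
    cells, each slot is cut according to the second cell, and so on. *)
Fixpoint left_end u : R :=
  if u is i :: u' then slot_start (left_end u') (fun j => mass (j :: u')) i else a.

Let piece u : set R := `[left_end u, left_end u + mass u[%classic.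

Let piece_cons i u : piece (i :: u) = slot (left_end u) (fun j => mass (j :: u)) i.
Proof. by rewrite /piece /slot slot_startS. Qed.

Let piece_split u : piece u = \bigcup_i piece (i :: u).
Proof.
rewrite [LHS](@slot_cover _ _ _ (fun j => mass (j :: u)))//.
by apply: eq_bigcupr => i _; rewrite piece_cons.
Qed.

(** The branch of the nested slots that contains [t]: this is the
    itinerary of the point to which [t] will be sent. *)
Fixpoint code n (t : R) : seq nat :=
  if n is n'.+1 then
    slot_index (left_end (code n' t)) (fun j => mass (j :: code n' t)) t :: code n' t
  else [::].

Let size_code n t : size (code n t) = n.
Proof. by elim: n => //= n ->. Qed.

Let piece_code n t : piece [::] t -> piece (code n t) t.
Proof.
move=> t0; elim: n => //= n; rewrite piece_split => -[i _ ti].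
rewrite (_ : slot_index _ _ _ = i)//.
by apply: slot_indexE => [k|]; rewrite -?piece_cons.
Qed.

Let pieceE u t : piece u t -> piece [::] t /\ code (size u) t = u.
Proof.
elim: u => [//|i u IH] ti.
have [t0 tu] : piece [::] t /\ code (size u) t = u.
  by apply: IH; rewrite piece_split; exists i.
split => //=; rewrite tu (_ : slot_index _ _ _ = i)//.
by apply: slot_indexE => [k|]; rewrite -?piece_cons.
Qed.

(** Codes and itineraries have the same law, as the slot of each finite
    branch has the mass of the corresponding intersection of cells. *)
Let code_law n (Q : set (seq nat)) :
  [/\ measurable (piece [::] `&` code n @^-1` Q),
      measurable (itinerary n @^-1` Q : set (borel X)) &
      lebesgue_measure (piece [::] `&` code n @^-1` Q) = nu (itinerary n @^-1` Q)].
Proof.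
have codeE u : piece [::] `&` code n @^-1` [set u] = if size u == n then piece u else set0.
  apply/seteqP; split=> [t [t0 /= <-]|t].
    by rewrite size_code eqxx; exact: piece_code.
  by case: eqP => // <- /pieceE[].
have itinE u : setT `&` itinerary n @^-1` [set u] =
    if size u == n then branch u else set0.
  rewrite setTI; apply/seteqP; split=> [x /= <-|x].
    by rewrite size_itinerary eqxx /branch /= size_itinerary.
  by case: eqP => // <-.
rewrite -[itinerary n @^-1` Q]setTI.
apply: (@law_countable_ext _ _ _ (borel X) _ lebesgue_measure nu _
  (piece [::]) setT (code n) (itinerary n) Q) => //.
- exact: measurable_itv.
- by move=> u; rewrite codeE; case: ifP => // _; exact: measurable_itv.
- by move=> u; rewrite itinE; case: ifP.
move=> u; rewrite codeE itinE; case: ifP => _; last by rewrite !measure0.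
by rewrite nu_branch; exact: lebesgue_itvco.
Qed.

Let approx n t : X := s (head 0%N (code n.+1 t)).

(** A slot that contains [t] has positive length, so the corresponding
    intersection of cells is nonempty, and any of its points is close to
    all the approximations. *)
Let approx_witness n t : piece [::] t ->
  exists x, forall k, (k <= n)%N -> mdist (approx k t) x < r k.
Proof.
move=> /(piece_code n.+1) tn.
have [x xn] : exists x, branch (code n.+1 t) x.
  apply: contrapT => /forallNP none; move: tn; rewrite /piece/= in_itv/=.
  rewrite (_ : mass _ = 0) ?addr0; first by case/andP => /le_lt_trans/[apply]; rewrite ltxx.
  by rewrite /mass (_ : branch _ = set0) ?measure0//; apply/seteqP; split => // x /none.
exists x => k kn.
have itin_code m : (m <= n)%N -> itinerary (n.+1 - m) x = code (n.+1 - m) t.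
  elim: m => [_|m IH mn].
    by move: (xn : itinerary (size (code n.+1 t)) x = _); rewrite size_code subn0.
  have := IH (ltnW mn); rewrite (_ : n.+1 - m = (n.+1 - m.+1).+1)%N; last by lia.
  by case.
have := itin_code (n - k)%N (leq_subr _ _).
rewrite (_ : n.+1 - (n - k) = k.+1)%N; last by lia.
by rewrite /approx => <-; have [] := cellP s_dense x (r_gt0 k).
Qed.

Let approx_close k n t : piece [::] t -> (k <= n)%N ->
  mdist (approx k t) (approx n t) < 2 * r k.
Proof.
move=> /(approx_witness n)[x xh] kn.
apply: le_lt_trans (metric_triangle _ x _) _; rewrite mulr_natl mulr2n ltrD ?xh//.
by rewrite metric_sym (lt_le_trans (xh _ (leqnn n)))// r_homo.
Qed.

Let g t : X := if t \in piece [::] then lim (approx n t @[n --> \oo]) else point.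

Let approx_lim k t : piece [::] t -> mdist (approx k t) (g t) < 3 * r k.
Proof.
move=> t0; rewrite /g mem_set//.
have cv : cvg (approx n t @[n --> \oo]).
  apply: cauchy_cvg; apply: cauchy_exP => e e0.
  have [m me] := r_small (divr_gt0 e0 (ltr0n R 2)).
  exists (approx m t); exists m => // n /= mn; rewrite ballEmdist/=.
  by apply: lt_le_trans (approx_close t0 mn) _; rewrite mulrC -ler_pdivlMr.
have /metricType_numDomainType.cvgrPdist_lt/(_ _ (r_gt0 k))[m _ mk] := cv.
have kn : (k <= maxn k m)%N by rewrite leq_maxl.
apply: le_lt_trans (metric_triangle _ (approx (maxn k m) t) _) _.
rewrite (_ : 3 * r k = 2 * r k + r k); last by ring.
rewrite ltrD//; first exact: approx_close.
by rewrite metric_sym; apply: mk; rewrite /= leq_maxr.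
Qed.

Let preimage_closed F : closed F -> piece [::] `&` g @^-1` F =
  piece [::] `&` \bigcap_n (code n.+1 @^-1` [set u | enlarge F (3 * r n) (s (head 0%N u))]).
Proof.
move=> cF; apply/seteqP; split=> t [t0 tF]; split => //.
  move=> n _; exists (g t) => //.
  by rewrite metric_sym; exact: approx_lim.
apply: (closed_enlarge (e := fun n => 6 * r n)) => //.
  move=> d d0; have [n nd] := r_small (divr_gt0 d0 (ltr0n R 6)).
  by exists n; rewrite mulrC -ler_pdivlMr.
move=> n _; rewrite (_ : 6 * r n = 3 * r n + 3 * r n); last by ring.
by apply: enlarge_mdist (tF n I) _; exact: approx_lim.
Qed.

Let measurable_g : measurable_fun setT (g : R -> borel X).
Proof.
have closed_pre F : closed F -> measurable (g @^-1` F).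
  move=> cF; rewrite -(setTI (g @^-1` F)) -(setUCl (piece [::])) setIUl.
  apply: measurableU.
    have [Fp|Fp] := pselect (F point).
      rewrite (_ : _ `&` _ = ~` piece [::]).
        by apply: measurableC; exact: measurable_itv.
      apply/seteqP; split=> [t []//|t nt]; split => //.
      by rewrite /= /g; case: ifPn => // /set_mem.
    rewrite (_ : _ `&` _ = set0)//.
    by apply/seteqP; split=> // t [nt] /=; rewrite /g; case: ifPn => // /set_mem.
  rewrite preimage_closed// -bigcapIr; last by exists 0%N.
  apply: bigcapT_measurable => n.
  by have [] := code_law n.+1 [set u | enlarge F (3 * r n) (s (head 0%N u))].
apply: (@measurability _ _ _ (borel X) _ _ (@open X)) => //.
move=> _ [U oU <-]; rewrite setTI -[U]setCK preimage_setC.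
apply: measurableC; have := closed_pre (~` U); apply; exact: open_closedC.
Qed.

(** The limit of the approximations has the law [nu]: at level [n] the
    approximation has the law of the image of [nu] under the map that
    moves each point to the center of its cell, hence by less than [r n],
    and closed sets together with their enlargements detect equality of
    measures. *)
Lemma realize_measure_on_interval :
  exists2 f : R -> borel X, measurable_fun setT f &
  forall B, measurable B ->
    lebesgue_measure (`[a, a + fine (nu setT)[ `&` f @^-1` B) = nu B.
Proof.
exists g; first exact: measurable_g.
have branch0 : branch [::] = setT by apply/seteqP; split.
have <- : piece [::] = `[a, a + fine (nu setT)[%classic by rewrite /piece /mass branch0.
have mp : measurable (piece [::]) by exact: measurable_itv.
have [rho rhoE] := image_measure lebesgue_measure mp
  (measurable_funS measurableT (@subsetT _ _) measurable_g).
have rho_fin : (rho setT < +oo)%E.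
  rewrite rhoE preimage_setT setIT; apply: le_lt_trans (ltry (mass [::])).
  by rewrite le_eqVlt; apply/orP; left; apply/eqP; exact: lebesgue_itvco.
move=> B mB; rewrite -rhoE; apply: eq_measure_closed mB => // F cF.
pose Q e := [set u : seq nat | enlarge F e (s (head 0%N u))].
have near_head n x : mdist (s (head 0%N (itinerary n.+1 x))) x < r n.
  by have [] := cellP s_dense x (r_gt0 n).
apply/eqP; rewrite eq_le; apply/andP; split.
  apply: le_measure_closed => // e e0.
  have [n ne] := r_small (divr_gt0 e0 (ltr0n R 4)).
  have [mQ mQ' lawQ] := code_law n.+1 (Q (3 * r n)).
  apply: (@le_trans _ _ (lebesgue_measure (piece [::] `&` code n.+1 @^-1` Q (3 * r n)))).
    rewrite rhoE; apply: le_measure; rewrite ?inE//.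
      by apply: measurable_funS measurable_g _ _ _ => //; exact: closed_borel.
    move=> t [t0 tF]; split => //; exists (g t) => //.
    by rewrite metric_sym; exact: approx_lim.
  rewrite lawQ; apply: le_measure; rewrite ?inE.
  - exact: mQ'.
  - exact: measurable_enlarge.
  move=> x xQ; have := enlarge_mdist xQ (near_head n x).
  by apply: enlarge_subset; move: ne; rewrite ler_pdivlMr//; lra.
apply: le_measure_closed => // e e0.
have [n ne] := r_small (divr_gt0 e0 (ltr0n R 4)).
have [mQ mQ' lawQ] := code_law n.+1 (Q (r n)).
apply: (@le_trans _ _ (lebesgue_measure (piece [::] `&` code n.+1 @^-1` Q (r n)))).
  rewrite lawQ; apply: le_measure; rewrite ?inE.
  - exact: closed_borel.
  - exact: mQ'.
  by move=> x xF; exists x => //; rewrite metric_sym; exact: near_head.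
rewrite rhoE; apply: le_measure; rewrite ?inE//.
  by apply: measurable_funS measurable_g _ _ _ => //; exact: measurable_enlarge.
move=> t [t0 tQ]; split => //; have := enlarge_mdist tQ (approx_lim n t0).
by apply: enlarge_subset; move: ne; rewrite ler_pdivlMr//; lra.
Qed.

End realization.

(** * Joint laws of variables with values in the naturals *)

Section nat_pairs.
Context d (T : measurableType d) (R : realType).
Variables (mu : {measure set T -> \bar R}) (D : set T) (Y Z : T -> nat).
Hypotheses (mD : measurable D) (mY : measurable_fun D Y) (mZ : measurable_fun D Z).
Local Open Scope ereal_scope.

Definition joint_law (i j : nat) : \bar R := mu (D `&` Y @^-1` [set i] `&` Z @^-1` [set j]).

Let mDY i : measurable (D `&` Y @^-1` [set i]). Proof. exact: mY. Qed.

Let mZi i : measurable_fun (D `&` Y @^-1` [set i]) Z.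
Proof. by apply: measurable_funS mZ => // t []. Qed.

Lemma measurable_joint i j : measurable (D `&` Y @^-1` [set i] `&` Z @^-1` [set j]).
Proof. exact: mZi. Qed.

Lemma measurable_nat_pair dU (U : sigmaRingType dU) (h : nat -> nat -> U) :
  measurable_fun D (fun t => h (Y t) (Z t)).
Proof.
have -> : D = \bigcup_i (D `&` Y @^-1` [set i]).
  by apply/seteqP; split=> [t Dt|t [k _ []]//]; exists (Y t).
apply/measurable_fun_bigcup => // i.
apply: (eq_measurable_fun (h i \o Z)).
  by move=> t /set_mem[_ /= ->].
exact: measurable_nat_comp.
Qed.

Lemma integral_nat_pair (h : nat -> nat -> \bar R) : (forall i j, 0 <= h i j) ->
  \int[mu]_(t in D) h (Y t) (Z t) = \sum_(i <oo) \sum_(j <oo) h i j * joint_law i j.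
Proof.
move=> h0.
have DE : D = \bigcup_i (D `&` Y @^-1` [set i]).
  by apply/seteqP; split=> [t Dt|t [k _ []]//]; exists (Y t).
rewrite [in LHS]DE ge0_integral_bigcup//=.
- apply: eq_eseriesr => i _; rewrite -integral_nat_valued//.
  by apply: eq_integral => t /set_mem[_ /= ->].
- by rewrite -DE; exact: measurable_nat_pair.
- exact: trivIset_preimage1_in.
Qed.

Lemma joint_law_suml i : \sum_(j <oo) joint_law i j = mu (D `&` Y @^-1` [set i]).
Proof.
rewrite -[in RHS](setIT (D `&` _)) -[setT](preimage_setT Z) law_nat//.
by rewrite [RHS](@eq_eseriesl _ _ xpredT)// => j; rewrite in_setT.
Qed.

End nat_pairs.

Lemma joint_law_sym d (T : measurableType d) (R : realType)
    (mu : {measure set T -> \bar R}) (D : set T) (Y Z : T -> nat) i j :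
  joint_law mu D Y Z i j = joint_law mu D Z Y j i.
Proof. by rewrite /joint_law setIAC. Qed.

Section transitions.
Context {R : realType}.
Local Open Scope ereal_scope.
Implicit Types (p : nat -> R) (q : nat -> nat -> R).

(** A coupling of two laws on the naturals, as a matrix with prescribed
    row and column sums. *)
Definition joint_pmf p1 p2 q :=
  [/\ forall i j, (0 <= q i j)%R,
      forall i, \sum_(j <oo) (q i j)%:E = (p1 i)%:E &
      forall j, \sum_(i <oo) (q i j)%:E = (p2 j)%:E].

Lemma joint_pmf_law d (T : measurableType d) (mu : {measure set T -> \bar R}) (D : set T)
    (Y Z : T -> nat) p1 p2 : measurable D -> measurable_fun D Y -> measurable_fun D Z ->
  (forall i, mu (D `&` Y @^-1` [set i]) = (p1 i)%:E) ->
  (forall i, mu (D `&` Z @^-1` [set i]) = (p2 i)%:E) ->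
  exists2 q, joint_pmf p1 p2 q & forall i j, joint_law mu D Y Z i j = (q i j)%:E.
Proof.
move=> mD mY mZ hY hZ.
have qE i j : joint_law mu D Y Z i j = (fine (joint_law mu D Y Z i j))%:E.
  rewrite fineK// ge0_fin_numE ?measure_ge0//.
  apply: le_lt_trans (_ : mu (D `&` Y @^-1` [set i]) < +oo); last by rewrite hY ltry.
  apply: le_measure; rewrite ?inE; [exact: measurable_joint|exact: mY|by move=> t []].
exists (fun i j => fine (joint_law mu D Y Z i j)) => //; split.
- by move=> i j; rewrite fine_ge0// measure_ge0.
- move=> i; under eq_eseriesr do rewrite -qE.
  by rewrite joint_law_suml.
- move=> j; under eq_eseriesr do rewrite -qE joint_law_sym.
  by rewrite joint_law_suml.
Qed.

Lemma joint_pmf_le p1 p2 q i j : joint_pmf p1 p2 q -> (q i j <= p1 i)%R.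
Proof.
move=> [q0 q1 q2]; rewrite -lee_fin -q1 (nneseriesD1 (n := j))//; last first.
  by move=> k _; rewrite lee_fin.
by rewrite leeDl// nneseries_ge0// => k _ _; rewrite lee_fin.
Qed.

(** The conditional law of the second variable given the value [i] of the
    first is [q i] divided by [p1 i], and it is realized as a function of
    a uniform variable. When [p1 i] vanishes, so does [q i], and any
    conditional law will do: the mass is put at 0. *)
Lemma transition_map p1 p2 q : joint_pmf p1 p2 q ->
  exists2 G : nat -> R -> nat,
    forall i, measurable_fun (`[0%R, 1%R[%classic : set R) (G i) &
    forall i j, (p1 i)%:E * lebesgue_measure (`[0%R, 1%R[ `&` G i @^-1` [set j]) = (q i j)%:E.
Proof.
move=> jq; have [q0 q1 q2] := jq.
have p10 i : (0 <= p1 i)%R by apply: le_trans (q0 i 0%N) (joint_pmf_le _ _ jq).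
pose w i j := (if p1 i == 0 then (j == 0)%N%:R else q i j / p1 i)%R.
have w0 i j : (0 <= w i j)%R by rewrite /w; case: ifP => // _; exact: divr_ge0.
have w1 i : \sum_(j <oo) (w i j)%:E = 1%:E.
  rewrite /w; case: eqVneq => [_|p1i].
    rewrite (nneseriesD1 (n := 0%N))// eseries0 ?adde0// => j _ /andP[_].
    by case: eqP.
  under eq_eseriesr do rewrite mulrC EFinM.
  rewrite nneseriesZl//; last by move=> j _; rewrite lee_fin.
  by rewrite q1 -EFinM mulVf.
exists (fun i => slot_index 0%R (w i)) => i; last move=> j.
  by have := @measurable_slot_index _ 0%R _ _ (w0 i) (w1 i); rewrite add0r.
have := @slot_index_preimage _ 0%R _ _ (w0 i) (w1 i) j; rewrite add0r => ->.
rewrite lebesgue_slot// -EFinM /w; congr EFin; case: eqVneq => [p1i|p1i].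
  by rewrite p1i mul0r; apply/eqP; rewrite eq_le q0/= -p1i (joint_pmf_le _ _ jq).
by rewrite mulrC divfK.
Qed.

End transitions.

Section extension.
Context d (T : measurableType d) (R : realType).
Variables (mu : {measure set T -> \bar R}) (D : set T).
Hypothesis mD : measurable D.
Local Open Scope ereal_scope.

Local Notation unit := (`[0%R, 1%R[%classic : set R).
Local Notation mu' := (mu \x lebesgue_measure).
Local Notation D' := (D `*` unit).

Let unit1 : lebesgue_measure unit = 1 :> \bar R.
Proof. by rewrite lebesgue_measure_itv/= lte_fin ltr01 -EFinB subr0. Qed.

Let munit : measurable unit. Proof. exact: measurable_itv. Qed.

Lemma measurable_extended_domain : measurable D'.
Proof. exact: measurableX. Qed.

Lemma measurable_fun_lift (Y : T -> nat) : measurable_fun D Y ->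
  measurable_fun D' (Y \o fst).
Proof.
move=> mY; apply: measurable_fun_nat => k.
rewrite (_ : _ `&` _ = (D `&` Y @^-1` [set k]) `*` unit).
  by apply: measurableX => //; exact: mY.
by apply/seteqP; split=> [[t x] [[/= Dt xI] Yt]|[t x] [[/= Dt Yt] xI]].
Qed.

Lemma law_lift (Y : T -> nat) k : measurable_fun D Y ->
  mu' (D' `&` (Y \o fst) @^-1` [set k]) = mu (D `&` Y @^-1` [set k]).
Proof.
move=> mY; rewrite (_ : _ `&` _ = (D `&` Y @^-1` [set k]) `*` unit).
  by rewrite product_measure1E//; [rewrite -[RHS]mule1 -unit1|exact: mY].
by apply/seteqP; split=> [[t x] [[/= Dt xI] Yt]|[t x] [[/= Dt Yt] xI]].
Qed.

Lemma joint_law_lift (Y Z : T -> nat) i j : measurable_fun D Y -> measurable_fun D Z ->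
  joint_law mu' D' (Y \o fst) (Z \o fst) i j = joint_law mu D Y Z i j.
Proof.
move=> mY mZ; rewrite /joint_law.
rewrite (_ : _ `&` _ `&` _ = (D `&` Y @^-1` [set i] `&` Z @^-1` [set j]) `*` unit).
  apply: etrans (product_measure1E _ _ _ _) _ => //.
    exact: measurable_joint.
  by rewrite -[RHS]mule1 -unit1.
apply/seteqP; split=> [[t x] [[[/= Dt xI] Yt] Zt]|[t x] [[[/= Dt Yt] Zt] xI]] //.
Qed.

Variables (p1 p2 : nat -> R) (q : nat -> nat -> R) (G : nat -> R -> nat) (Y : T -> nat).
Hypothesis mY : measurable_fun D Y.
Hypothesis mG : forall i, measurable_fun unit (G i).
Hypothesis lawY : forall i, mu (D `&` Y @^-1` [set i]) = (p1 i)%:E.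
Hypothesis lawG : forall i j,
  (p1 i)%:E * lebesgue_measure (unit `&` G i @^-1` [set j]) = (q i j)%:E.

(** On the product of the sample space with the unit interval, the second
    coordinate is a fresh uniform variable, which draws the next value
    from the present one [Y]. *)
Definition extend (z : T * R) : nat := G (Y z.1) z.2.

Let extend_rect i j :
  D' `&` (Y \o fst) @^-1` [set i] `&` extend @^-1` [set j] =
  (D `&` Y @^-1` [set i]) `*` (unit `&` G i @^-1` [set j]).
Proof.
apply/seteqP; split=> -[t x].
  by case=> -[[/= Dt xI] /= Yt]; rewrite /extend/= Yt => Gx.
by case=> -[/= Dt Yt] [xI Gx]; split => //=; rewrite /extend/= Yt.
Qed.

Lemma joint_law_extend i j : joint_law mu' D' (Y \o fst) extend i j = (q i j)%:E.
Proof.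
rewrite /joint_law extend_rect; apply: etrans (product_measure1E _ _ _ _) _.
- exact: mY.
- exact: mG.
- by rewrite [X in X * _]lawY -lawG.
Qed.

Lemma measurable_extend : measurable_fun D' extend.
Proof.
apply: measurable_fun_nat => j.
have -> : D' `&` extend @^-1` [set j] =
    \bigcup_i (D' `&` (Y \o fst) @^-1` [set i] `&` extend @^-1` [set j]).
  apply/seteqP; split=> [z [Dz ez]|z [i _ [[Dz _] ez]]]; last by split.
  by exists (Y z.1).
apply: bigcupT_measurable => i; rewrite extend_rect.
by apply: measurableX; [exact: mY|exact: mG].
Qed.

Lemma law_extend j : joint_pmf p1 p2 q -> mu' (D' `&` extend @^-1` [set j]) = (p2 j)%:E.
Proof.
move=> [_ _ <-].
rewrite -(joint_law_suml mu' measurable_extended_domain measurable_extend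
  (measurable_fun_lift mY)).
by apply: eq_eseriesr => i _; rewrite joint_law_sym joint_law_extend.
Qed.

End extension.

(** * Coupling along chains of labels *)

Section discrete_transport.
Context {R : realType}.
Variable C : nat -> nat -> R.
Hypothesis C_ge0 : forall i j, 0 <= C i j.
Hypothesis C_diag : forall i, C i i = 0.
Hypothesis C_sym : forall i j, C i j = C j i.
Hypothesis C_tri : forall i j k, C i k <= C i j + C j k.
Local Open Scope ereal_scope.
Implicit Types (p : nat -> R) (q : nat -> nat -> R).

Definition is_pmf p := (forall i, (0 <= p i)%R) /\ \sum_(i <oo) (p i)%:E = 1%:E.

Definition joint_cost q : \bar R := \sum_(i <oo) \sum_(j <oo) (C i j)%:E * (q i j)%:E.

Local Notation unit := (`[0%R, 1%R[%classic : set R).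

Let munit : measurable unit. Proof. exact: measurable_itv. Qed.

Lemma pmf_variable p : is_pmf p -> measurable_fun unit (slot_index 0%R p) /\
  forall i, lebesgue_measure (unit `&` slot_index 0%R p @^-1` [set i]) = (p i)%:E.
Proof.
move=> [p0 p1]; split.
  by have := @measurable_slot_index _ 0%R _ _ p0 p1; rewrite add0r.
move=> i; have := @slot_index_preimage _ 0%R _ _ p0 p1 i; rewrite add0r => ->.
exact: lebesgue_slot.
Qed.

Lemma integral_joint_cost d (T : measurableType d) (mu : {measure set T -> \bar R})
    (D : set T) (Y Z : T -> nat) q : measurable D -> measurable_fun D Y -> measurable_fun D Z ->
  (forall i j, joint_law mu D Y Z i j = (q i j)%:E) ->
  \int[mu]_(t in D) (C (Y t) (Z t))%:E = joint_cost q.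
Proof.
move=> mD mY mZ hq.
rewrite (integral_nat_pair mu mD mY mZ (h := fun i j => (C i j)%:E)); last first.
  by move=> i j; rewrite lee_fin.
by apply: eq_eseriesr => i _; apply: eq_eseriesr => j _; rewrite hq.
Qed.

Lemma integral_cost_triangle d (T : measurableType d) (mu : {measure set T -> \bar R})
    (D : set T) (Y Z W : T -> nat) : measurable D -> measurable_fun D Y ->
  measurable_fun D Z -> measurable_fun D W ->
  \int[mu]_(t in D) (C (Y t) (W t))%:E <=
  \int[mu]_(t in D) (C (Y t) (Z t))%:E + \int[mu]_(t in D) (C (Z t) (W t))%:E.
Proof.
move=> mD mY mZ mW.
have mC Y1 Y2 : measurable_fun D Y1 -> measurable_fun D Y2 ->
    measurable_fun D ((fun t => (C (Y1 t) (Y2 t))%:E) : T -> \bar R).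
  by move=> m1 m2; exact: (measurable_nat_pair mD m1 m2 (fun i j => (C i j)%:E)).
rewrite -ge0_integralD//; try exact: mC; try by move=> t _; rewrite lee_fin.
apply: integral_mono => t _; first by rewrite lee_fin.
by rewrite -EFinD lee_fin.
Qed.

Lemma exists_joint_pmf p1 p2 : is_pmf p1 -> is_pmf p2 -> exists q, joint_pmf p1 p2 q.
Proof.
move=> /pmf_variable[m1 l1] /pmf_variable[m2 l2].
by have [q] := joint_pmf_law (mu := lebesgue_measure) munit m1 m2 l1 l2; exists q.
Qed.

Lemma exists_diagonal_pmf p : is_pmf p -> exists2 q, joint_pmf p p q & joint_cost q = 0.
Proof.
move=> /pmf_variable[m l]; have [q jq qE] := joint_pmf_law (mu := lebesgue_measure) munit m m l l.
exists q => //; rewrite -(integral_joint_cost (mu := lebesgue_measure) munit m m qE).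
by under eq_integral do rewrite C_diag; rewrite integral0.
Qed.

Lemma joint_pmf_variables p1 p2 q : is_pmf p1 -> joint_pmf p1 p2 q ->
  exists d (T : measurableType d) (mu : {measure set T -> \bar R}) (D : set T) (Y Z : T -> nat),
  [/\ measurable D, measurable_fun D Y, measurable_fun D Z,
      forall i j, joint_law mu D Y Z i j = (q i j)%:E &
      (forall i, mu (D `&` Y @^-1` [set i]) = (p1 i)%:E) /\
      (forall i, mu (D `&` Z @^-1` [set i]) = (p2 i)%:E)].
Proof.
move=> /pmf_variable[m l] j; have [G mG lG] := transition_map j.
exists _, _, (lebesgue_measure \x lebesgue_measure), (unit `*` unit),
  (slot_index 0%R p1 \o fst), (extend G (slot_index 0%R p1)); split.
- exact: measurable_extended_domain.
- exact: measurable_fun_lift.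
- exact: measurable_extend.
- exact: (joint_law_extend (mu := lebesgue_measure) munit m mG l lG).
- split=> i; first exact: etrans (law_lift lebesgue_measure munit i m) (l i).
  exact: (law_extend (mu := lebesgue_measure) munit m mG l lG).
Qed.

(** Gluing: from variables realizing [q1] draw a third one by the
    transition of [q2]; the joint law of the first and the third is the
    required coupling. *)
Lemma joint_pmf_triangle p1 p2 p3 q1 q2 : is_pmf p1 ->
  joint_pmf p1 p2 q1 -> joint_pmf p2 p3 q2 ->
  exists2 q, joint_pmf p1 p3 q & joint_cost q <= joint_cost q1 + joint_cost q2.
Proof.
move=> pp1 /(joint_pmf_variables pp1)[d [T [mu [D [X [Y [mD mX mY lXY [lX lY]]]]]]]] j2.
have [G mG lG] := transition_map j2.
have mX' := measurable_fun_lift (R := R) mD mX.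
have mY' := measurable_fun_lift (R := R) mD mY.
have mZ := measurable_extend mD mY mG.
have mD' := measurable_extended_domain (R := R) mD.
have lX' i := etrans (law_lift mu mD i mX) (lX i).
have lZ i := law_extend mD mY mG lY lG i j2.
have [q jq qE] := joint_pmf_law (mu := mu \x lebesgue_measure) mD' mX' mZ lX' lZ.
exists q => //; rewrite -(integral_joint_cost (mu := mu \x lebesgue_measure) mD' mX' mZ qE).
apply: le_trans (integral_cost_triangle (mu \x lebesgue_measure) mD' mX' mY' mZ) _.
rewrite (integral_joint_cost (mu := mu \x lebesgue_measure) (q := q1) mD' mX' mY')
  ?(integral_joint_cost (mu := mu \x lebesgue_measure) (q := q2) mD' mY' mZ)//.
  by move=> i j; apply: joint_law_extend => //; exact: lY.
by move=> i j; rewrite joint_law_lift.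
Qed.

Section chains.
Variables (A : Type) (p : A -> nat -> R) (q : A -> A -> nat -> nat -> R).
Hypothesis p_pmf : forall a, is_pmf (p a).
Hypothesis q_joint : forall a b, joint_pmf (p a) (p b) (q a b).
Variables (c : nat -> A -> A) (bound : nat -> A -> A -> \bar R).
Hypothesis bound_ge0 : forall M u v, 0 <= bound M u v.
Hypothesis bound0 : forall u v, c 0 u <> c 0 v -> bound 0 u v = +oo.
Hypothesis boundS : forall M u v, ~ (forall j, (j <= M.+1)%N -> c j u = c j v) ->
  bound M u v + joint_cost (q (c M u) (c M.+1 u)) + joint_cost (q (c M v) (c M.+1 v))
    <= bound M.+1 u v.

(** All the [Y u] are drawn at each level from the same uniform variable,
    so that they coincide for two points whose labels agree up to that
    level. The cost is otherwise increased by at most the costs of the two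
    transitions. The hypotheses on [bound] record this growth; infinite
    bounds allow labels that differ from the start. *)
Lemma chain_coupling M : exists d (T : measurableType d) (mu : {measure set T -> \bar R})
    (D : set T) (Y : A -> T -> nat),
  [/\ measurable D, forall u, measurable_fun D (Y u),
      forall u i, mu (D `&` Y u @^-1` [set i]) = (p (c M u) i)%:E,
      forall u v, (forall j, (j <= M)%N -> c j u = c j v) -> Y u = Y v &
      forall u v, \int[mu]_(t in D) (C (Y u t) (Y v t))%:E <= bound M u v].
Proof.
elim: M => [|M [d [T [mu [D [Y [mD mY lY eqY costY]]]]]]].
  exists _, _, lebesgue_measure, unit, (fun u => slot_index 0%R (p (c 0%N u))); split.
  - exact: munit.
  - by move=> u; exact: (pmf_variable (p_pmf (c 0%N u))).1.
  - by move=> u i; exact: (pmf_variable (p_pmf (c 0%N u))).2.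
  - by move=> u v /(_ 0%N isT) ->.
  move=> u v; have [uv|/bound0 ->] := pselect (c 0%N u = c 0%N v); last exact: leey.
  by rewrite uv; under eq_integral do rewrite C_diag; rewrite integral0 bound_ge0.
have [G Gp] : exists G : A -> A -> nat -> R -> nat, forall a b,
    (forall i, measurable_fun unit (G a b i)) /\
    forall i j, (p a i)%:E * lebesgue_measure (unit `&` G a b i @^-1` [set j]) = (q a b i j)%:E.
  have H a b : {G : nat -> R -> nat | (forall i, measurable_fun unit (G i)) /\
      forall i j, (p a i)%:E * lebesgue_measure (unit `&` G i @^-1` [set j]) = (q a b i j)%:E}.
    by apply: cid; have [G ? ?] := transition_map (q_joint a b); exists G.
  by exists (fun a b => sval (H a b)) => a b; exact: (svalP (H a b)).
pose Gu u := G (c M u) (c M.+1 u).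
pose Y' u := extend (Gu u) (Y u).
have mG u := (Gp (c M u) (c M.+1 u)).1.
have lG u := (Gp (c M u) (c M.+1 u)).2.
have mD' := measurable_extended_domain (R := R) mD.
have mY' u : measurable_fun (D `*` unit) (Y' u) := measurable_extend mD (mY u) (mG u).
have jE u i j := joint_law_extend mD (mY u) (mG u) (lY u) (lG u) i j.
have mYl u := measurable_fun_lift (R := R) mD (mY u).
exists _, _, (mu \x lebesgue_measure), (D `*` unit), Y'; split => //.
- by move=> u j; exact: law_extend (mG u) (lY u) (lG u) _ _.
- move=> u v uv; rewrite /Y' /Gu (eqY u v); last by move=> j jM; rewrite uv// ltnW.
  by rewrite !uv.
move=> u v.
have [uv|nuv] := pselect (forall j, (j <= M.+1)%N -> c j u = c j v).
  rewrite /Y' /Gu (eqY u v); last by move=> j jM; rewrite uv// ltnW.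
  by rewrite !uv//; under eq_integral do rewrite C_diag; rewrite integral0 bound_ge0.
apply: le_trans (boundS nuv).
apply: le_trans (integral_cost_triangle (mu \x lebesgue_measure) mD' (mY' u) (mYl u) (mY' v)) _.
rewrite [leRHS]addeAC [leRHS]addeC; apply: leeD.
  under eq_integral do rewrite C_sym.
  rewrite (integral_joint_cost (mu := mu \x lebesgue_measure) mD' (mYl u) (mY' u)
    (q := q (c M u) (c M.+1 u)))//.
apply: le_trans (integral_cost_triangle (mu \x lebesgue_measure) mD' (mYl u) (mYl v) (mY' v)) _.
apply: leeD; last first.
  rewrite (integral_joint_cost (mu := mu \x lebesgue_measure) mD' (mYl v) (mY' v)
    (q := q (c M v) (c M.+1 v)))//.
apply: le_trans (costY u v).
rewrite (integral_nat_pair (mu \x lebesgue_measure) mD' (mYl u) (mYl v)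
    (h := fun i j => (C i j)%:E))
  ?(integral_nat_pair mu mD (mY u) (mY v) (h := fun i j => (C i j)%:E))//.
rewrite le_eqVlt; apply/orP; left; apply/eqP.
by apply: eq_eseriesr => i _; apply: eq_eseriesr => j _; rewrite joint_law_lift.
Qed.

End chains.

End discrete_transport.

(** * The discrete transport cost and its integer rounding *)

Section discrete_distance.
Context {R : realType}.
Variable C : nat -> nat -> R.
Hypothesis C_ge0 : forall i j, 0 <= C i j.
Hypothesis C_diag : forall i, C i i = 0.
Hypothesis C_sym : forall i j, C i j = C j i.
Hypothesis C_tri : forall i j k, C i k <= C i j + C j k.
Local Open Scope ereal_scope.
Implicit Types (p : nat -> R) (q : nat -> nat -> R).

Definition discrete_cost p1 p2 : \bar R :=
  ereal_inf [set joint_cost C q | q in joint_pmf p1 p2].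

Lemma joint_cost_ge0 p1 p2 q : joint_pmf p1 p2 q -> 0 <= joint_cost C q.
Proof.
move=> [q0 _ _]; apply: nneseries_ge0 => i _ _; apply: nneseries_ge0 => j _ _.
by rewrite mule_ge0// lee_fin.
Qed.

Lemma discrete_cost_ge0 p1 p2 : 0 <= discrete_cost p1 p2.
Proof. by apply: le_ereal_inf_tmp => _ [q /joint_cost_ge0 ? <-]. Qed.

Lemma discrete_cost_sym p1 p2 : discrete_cost p1 p2 = discrete_cost p2 p1.
Proof.
rewrite /discrete_cost; congr ereal_inf.
suff H p p' : [set joint_cost C q | q in joint_pmf p p'] `<=`
    [set joint_cost C q | q in joint_pmf p' p] by apply/seteqP; split; exact: H.
move=> _ [q [q0 q1 q2] <-]; exists (fun i j => q j i); first by split.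
rewrite /joint_cost nneseries_interchange.
  by apply: eq_eseriesr => i _; apply: eq_eseriesr => j _; rewrite C_sym.
by move=> i j; rewrite mule_ge0// lee_fin.
Qed.

Lemma discrete_cost_diag p : is_pmf p -> discrete_cost p p = 0.
Proof.
move=> /(exists_diagonal_pmf C_ge0 C_diag)[q jq q0].
apply/eqP; rewrite eq_le discrete_cost_ge0 andbT -q0.
by apply: ereal_inf_lbound; exists q.
Qed.

Lemma discrete_cost_lt p1 p2 e : discrete_cost p1 p2 < e ->
  exists2 q, joint_pmf p1 p2 q & joint_cost C q < e.
Proof. by move=> /ereal_inf_lt[_ [q jq <-] qe]; exists q. Qed.

(** Glue two couplings that are optimal up to [e / 2]. *)
Lemma discrete_cost_triangle p1 p2 p3 : is_pmf p1 ->
  discrete_cost p1 p3 <= discrete_cost p1 p2 + discrete_cost p2 p3.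
Proof.
move=> pp1; have [h12|h12] := ltP (discrete_cost p1 p2) +oo; last first.
  rewrite leye_eq in h12; rewrite (eqP h12) addye ?leey//.
  by rewrite gt_eqF// (lt_le_trans _ (discrete_cost_ge0 _ _)).
have [h23|h23] := ltP (discrete_cost p2 p3) +oo; last first.
  rewrite leye_eq in h23; rewrite (eqP h23) addey ?leey//.
  by rewrite gt_eqF// (lt_le_trans _ (discrete_cost_ge0 _ _)).
apply/lee_addgt0Pr => e e0.
have e2 : (0 < e / 2)%R by rewrite divr_gt0.
have [q1 j1 c1] : exists2 q, joint_pmf p1 p2 q &
    joint_cost C q < discrete_cost p1 p2 + (e / 2)%:E.
  by apply: discrete_cost_lt; rewrite lteDl ?lte_fin// ge0_fin_numE// discrete_cost_ge0.
have [q2 j2 c2] : exists2 q, joint_pmf p2 p3 q &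
    joint_cost C q < discrete_cost p2 p3 + (e / 2)%:E.
  by apply: discrete_cost_lt; rewrite lteDl ?lte_fin// ge0_fin_numE// discrete_cost_ge0.
have [q jq qc] := joint_pmf_triangle C_ge0 C_tri pp1 j1 j2.
apply: le_trans (_ : joint_cost C q <= _); first by apply: ereal_inf_lbound; exists q.
apply: le_trans qc _; apply: le_trans (leeD (ltW c1) (ltW c2)) _.
by rewrite addeACA -EFinD -splitr.
Qed.

End discrete_distance.

Section rounded_metric.
Context {R : realType}.
Variable C : nat -> nat -> R.
Hypothesis C_ge0 : forall i j, 0 <= C i j.
Hypothesis C_diag : forall i, C i i = 0.
Hypothesis C_sym : forall i j, C i j = C j i.
Hypothesis C_tri : forall i j k, C i k <= C i j + C j k.
Variables (A : finType) (p : A -> nat -> R).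
Hypothesis p_pmf : forall a, is_pmf (p a).
Variable delta : R.
Hypothesis delta_gt0 : 0 < delta.

Let dc a b := discrete_cost C (p a) (p b).

Let dc_ge0 a b : (0 <= dc a b)%E. Proof. exact: discrete_cost_ge0. Qed.

Let dc_fin a b : (dc a b < +oo)%E -> dc a b = (fine (dc a b))%:E.
Proof. by move=> h; rewrite fineK// ge0_fin_numE. Qed.

Let finite_steps a b : nat := if a == b then 0%N else (Num.truncn (fine (dc a b) / delta)).+1.

(** An exponent for which 4 ^ top_scale exceeds all the finite distances. *)
Definition top_scale : nat := \max_(ab : A * A) finite_steps ab.1 ab.2.

(** The transport cost in units of [delta], rounded up to the next larger
    integer, which preserves the triangle inequality and leaves room for a
    coupling of smaller cost. Infinite costs become a distance that no
    ball of the hierarchy reaches, so that the clusters only contain laws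
    at finite distance from each other. *)
Definition steps a b : nat := if (dc a b < +oo)%E then finite_steps a b else (4 ^ top_scale.+1)%N.

Let finite_steps_le a b : (finite_steps a b <= 4 ^ top_scale)%N.
Proof.
apply: leq_trans (@leq_bigmax _ (fun ab : A * A => finite_steps ab.1 ab.2) (a, b)) _.
by apply: ltnW; exact: ltn_expl.
Qed.

Lemma steps_diag a : steps a a = 0%N.
Proof. by rewrite /steps /dc discrete_cost_diag// ltry /finite_steps eqxx. Qed.

Lemma steps_sym a b : steps a b = steps b a.
Proof. by rewrite /steps /finite_steps /dc (discrete_cost_sym C_ge0 C_sym) eq_sym. Qed.

Lemma steps_gap a b : (steps a b <= 4 ^ top_scale)%N || (4 ^ top_scale.+1 <= steps a b)%N.
Proof. by rewrite /steps; case: ifP; rewrite ?finite_steps_le ?leqnn ?orbT. Qed.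

Lemma steps_fin a b : (steps a b <= 4 ^ top_scale)%N = (dc a b < +oo)%E.
Proof.
rewrite /steps; case: ifP => _; first exact: finite_steps_le.
by rewrite leq_exp2l// ltnn.
Qed.

Lemma steps_eq0 a b : steps a b = 0%N -> a = b.
Proof.
rewrite /steps /finite_steps; case: ifP => _; first by case: eqP.
by move/eqP; rewrite expn_eq0.
Qed.

Lemma steps_triangle a b c : (steps a c <= steps a b + steps b c)%N.
Proof.
have le_top u v : (dc u v < +oo)%E -> (steps u v <= 4 ^ top_scale.+1)%N.
  by rewrite -steps_fin => h; apply: leq_trans h _; rewrite leq_exp2l.
have steps_oo u v : (dc u v < +oo)%E = false -> steps u v = (4 ^ top_scale.+1)%N.
  by rewrite /steps => ->.
have all_le u v : (steps u v <= 4 ^ top_scale.+1)%N.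
  by case h : (dc u v < +oo)%E; [exact: le_top|rewrite steps_oo].
case hab : (dc a b < +oo)%E; last by rewrite (steps_oo _ _ hab) (leq_trans (all_le _ _))// leq_addr.
case hbc : (dc b c < +oo)%E; last by rewrite (steps_oo _ _ hbc) (leq_trans (all_le _ _))// leq_addl.
have tri : (dc a c <= dc a b + dc b c)%E by exact: discrete_cost_triangle.
have hac : (dc a c < +oo)%E by apply: le_lt_trans tri _; rewrite lte_add_pinfty.
rewrite /steps hab hbc hac /finite_steps.
have [->//|ac] := eqVneq a c.
have [<-|_] := eqVneq a b; first by rewrite (negbTE ac) add0n.
have [->|_] := eqVneq b c; first by rewrite addn0.
move: tri; rewrite (dc_fin hab) (dc_fin hbc) (dc_fin hac) -EFinD lee_fin => tri.
rewrite addSn addnS ltnS.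
have f0 u v : 0 <= fine (dc u v) / delta by rewrite divr_ge0 ?fine_ge0// ltW.
rewrite -ltnS truncn_lt_nat; last exact: f0.
apply: le_lt_trans (_ : fine (dc a b) / delta + fine (dc b c) / delta < _).
  by rewrite -mulrDl ler_pM2r ?invr_gt0.
rewrite -addSn -addnS natrD ltrD// -?natr1 ?natr1; exact: truncnS_gt.
Qed.

Lemma le_steps a b : a != b -> (dc a b < +oo)%E ->
  delta * (steps a b)%:R <= fine (dc a b) + delta.
Proof.
move=> ab h; rewrite /steps h /finite_steps (negbTE ab) -natr1 mulrDr mulr1 lerD2r.
rewrite mulrC -ler_pdivlMr// -truncn_ge_nat// divr_ge0 ?fine_ge0//.
exact: ltW.
Qed.

Lemma steps_coupling a b : exists2 q, joint_pmf (p a) (p b) q &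
  (dc a b < +oo)%E -> (joint_cost C q <= (delta * (steps a b)%:R)%:E)%E.
Proof.
case h : (dc a b < +oo)%E; last first.
  by have [q jq] := exists_joint_pmf (p_pmf a) (p_pmf b); exists q.
rewrite /steps h /finite_steps; have [<-|_] := eqVneq a b.
  have [q jq q0] := exists_diagonal_pmf C_ge0 C_diag (p_pmf a).
  by exists q => // _; rewrite q0 mulr0.
have [q jq qc] : exists2 q, joint_pmf (p a) (p b) q &
    (joint_cost C q < (delta * (Num.truncn (fine (dc a b) / delta)).+1%:R)%:E)%E.
  apply: discrete_cost_lt; rewrite -/(dc a b) (dc_fin h) lte_fin.
  by rewrite mulrC -ltr_pdivrMr// truncnS_gt.
by exists q => // _; exact: ltW.
Qed.

End rounded_metric.

(** * Averaging the hierarchical couplings *)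

Section joint_distributions.
Context {R : realType}.
Variable C : nat -> nat -> R.
Hypothesis C_ge0 : forall i j, 0 <= C i j.
Variables (A : finType) (a0 : A) (p : A -> nat -> R).
Local Open Scope ereal_scope.

(** A natural number encodes the values of all the variables at once. *)
Definition label (k : nat) (a : A) : nat :=
  if unpickle k is Some z then (z : {ffun A -> nat}) a else 0%N.

(** Some joint law of the variables, given by the weights [w] of their
    common code, has marginals [p] and costs bounded by [b]. This form is
    stable under finite mixtures. *)
Definition attainable (b : A -> A -> \bar R) := exists w : nat -> R,
  [/\ forall k, (0 <= w k)%R,
      forall a i, \sum_(k <oo) (w k * (label k a == i)%:R)%:E = (p a i)%:E &
      forall u v, \sum_(k <oo) (w k * C (label k u) (label k v))%:E <= b u v].

Lemma attainable_variables d (T : measurableType d) (mu : {measure set T -> \bar R})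
    (D : set T) (Y : A -> T -> nat) (b : A -> A -> \bar R) :
  measurable D -> (forall u, measurable_fun D (Y u)) ->
  (forall u i, mu (D `&` Y u @^-1` [set i]) = (p u i)%:E) ->
  (forall u v, \int[mu]_(t in D) (C (Y u t) (Y v t))%:E <= b u v) -> attainable b.
Proof.
move=> mD mY lY costY.
pose Z t := pickle [ffun a => Y a t].
have ZE t a : label (Z t) a = Y a t by rewrite /label pickleK ffunE.
have mZ : measurable_fun D Z.
  apply: measurable_fun_nat => k.
  case E : (@pickle_inv {ffun A -> nat} k) => [z|]; last first.
    rewrite (_ : _ `&` _ = set0)//; apply/seteqP; split=> // t [_ /= tk].
    by move: E; rewrite -tk pickleK_inv.
  have kz : pickle z = k by have := @pickle_invK {ffun A -> nat} k; rewrite /ocancel E.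
  rewrite (_ : _ `&` _ = D `&`
      \bigcap_(a in [set: A]) (D `&` Y a @^-1` [set (z : {ffun A -> nat}) a])).
    apply: measurableI => //; apply: fin_bigcap_measurable => // a _; exact: mY.
  apply/seteqP; split=> t [Dt].
    move=> /= tk; split => // a _; split => //=; rewrite -ZE.
    by rewrite tk -kz /label pickleK.
  move=> tz; split => //=; rewrite -kz; congr pickle; apply/ffunP => a; rewrite ffunE.
  by have [] := tz a I.
have wE k : mu (D `&` Z @^-1` [set k]) = (fine (mu (D `&` Z @^-1` [set k])))%:E.
  rewrite fineK// ge0_fin_numE//.
  apply: le_lt_trans (_ : mu (D `&` Y a0 @^-1` [set label k a0]) < +oo); last first.
    by rewrite lY ltry.
  apply: le_measure; rewrite ?inE; [exact: mZ|exact: mY|].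
  by move=> t [Dt /= <-]; split => //=; rewrite ZE.
exists (fun k => fine (mu (D `&` Z @^-1` [set k]))); split.
- by move=> k; rewrite fine_ge0.
- move=> a i; rewrite -lY.
  have -> : D `&` Y a @^-1` [set i] = D `&` Z @^-1` [set k | label k a = i].
    by apply/seteqP; split=> t [Dt /= h]; split => //=; move: h; rewrite ZE.
  rewrite law_nat// [RHS]eseries_mkcond; apply: eq_eseriesr => k _.
  rewrite EFinM -wE; case: eqP => [ki|ki]; first by rewrite mem_set// mule1.
  by rewrite memNset// mule0.
- move=> u v; apply: le_trans (costY u v).
  under eq_integral do rewrite -!ZE.
  rewrite (integral_nat_valued mu (h := fun k => (C (label k u) (label k v))%:E))//.
    rewrite le_eqVlt; apply/orP; left; apply/eqP.
    by apply: eq_eseriesr => k _; rewrite EFinM -wE muleC.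
  by move=> k; rewrite lee_fin.
Qed.

Lemma attainable_mixture (I : finType) (P : pred I) (W : I -> R) (b : I -> A -> A -> \bar R) :
  (forall i, P i -> (0 <= W i)%R) -> (\sum_(i | P i) W i = 1)%R ->
  (forall i, P i -> attainable (b i)) ->
  attainable (fun u v => \sum_(i | P i) (W i)%:E * b i u v).
Proof.
move=> W0 W1 Pb.
have [w wP] : exists w : I -> nat -> R, forall i, P i ->
  [/\ forall k, (0 <= w i k)%R,
      forall a j, \sum_(k <oo) (w i k * (label k a == j)%:R)%:E = (p a j)%:E &
      forall u v, \sum_(k <oo) (w i k * C (label k u) (label k v))%:E <= b i u v].
  have H i : {w : nat -> R | P i -> [/\ forall k, (0 <= w k)%R,
      forall a j, \sum_(k <oo) (w k * (label k a == j)%:R)%:E = (p a j)%:E &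
      forall u v, \sum_(k <oo) (w k * C (label k u) (label k v))%:E <= b i u v]}.
    apply: cid; case Pi : (P i); last by exists (fun=> 0%R).
    by have [w ?] := Pb i Pi; exists w.
  by exists (fun i => sval (H i)) => i; exact: (svalP (H i)).
have mix (g : nat -> R) : (forall k, (0 <= g k)%R) ->
    \sum_(k <oo) ((\sum_(i | P i) W i * w i k) * g k)%:E =
    \sum_(i | P i) (W i)%:E * \sum_(k <oo) (w i k * g k)%:E.
  move=> g0; under eq_eseriesr do rewrite mulr_suml -sumEFin.
  rewrite nneseries_sum; last first.
    by move=> i k Pi; have [w0 _ _] := wP i Pi; rewrite lee_fin !mulr_ge0// W0.
  apply: eq_bigr => i Pi; have [w0 _ _] := wP i Pi.
  rewrite -nneseriesZl; last by move=> k _; rewrite lee_fin mulr_ge0.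
  by apply: eq_eseriesr => k _; rewrite -EFinM mulrA.
exists (fun k => (\sum_(i | P i) W i * w i k)%R); split.
- by move=> k; apply: sumr_ge0 => i Pi; have [w0 _ _] := wP i Pi; rewrite mulr_ge0// W0.
- move=> a j; rewrite mix; last by move=> k; exact: ler0n.
  transitivity (\sum_(i | P i) (W i * p a j)%:E).
    by apply: eq_bigr => i Pi; have [_ w1 _] := wP i Pi; rewrite w1.
  by rewrite sumEFin -mulr_suml W1 mul1r.
- move=> u v; rewrite mix//; apply: lee_sum => i Pi; have [_ _ w2] := wP i Pi.
  by apply: lee_wpmul2l; rewrite ?w2// lee_fin W0.
Qed.

End joint_distributions.

Section random_hierarchy.
Context {R : realType}.
Variable C : nat -> nat -> R.
Hypothesis C_ge0 : forall i j, 0 <= C i j.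
Hypothesis C_diag : forall i, C i i = 0.
Hypothesis C_sym : forall i j, C i j = C j i.
Hypothesis C_tri : forall i j k, C i k <= C i j + C j k.
Variables (A : finType) (p : A -> nat -> R).
Hypothesis p_pmf : forall a, is_pmf (p a).
Hypothesis A_gt1 : (1 < #|A|)%N.
Variable delta : R.
Hypothesis delta_gt0 : 0 < delta.

Let N := steps C p delta.
Let m := top_scale C p delta.

Let N_diag a : N a a = 0%N. Proof. exact: steps_diag. Qed.
Let N_sym a b : N a b = N b a. Proof. exact: steps_sym. Qed.
Let N_tri a b c : (N a c <= N a b + N b c)%N. Proof. exact: steps_triangle. Qed.
Let N_gap a b : (N a b < 4 ^ m.+1)%N -> (N a b <= 4 ^ m)%N.
Proof. by move=> h; have /orP[//|] := steps_gap C p delta a b; rewrite leqNgt h. Qed.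

Let N_close_trans a b c : (N a b <= 4 ^ m)%N -> (N b c <= 4 ^ m)%N -> (N a c <= 4 ^ m)%N.
Proof.
move=> ab bc; apply: N_gap; apply: leq_ltn_trans (N_tri a b c) _.
apply: leq_ltn_trans (leq_add ab bc) _; rewrite expnS addnn -mul2n ltn_pmul2r//.
by rewrite expn_gt0.
Qed.

Section fixed_sample.
Variables (s : {perm A}) (x : nat).
Hypotheses (x_ge : (4 ^ m <= x)%N) (x_lt : (x < 4 ^ m.+1)%N).

Let c j u := cluster_center N s x j u.

Let center_le j u : (N u (c j u) * 4 ^ j <= x)%N.
Proof. by have [] := cluster_centerP N_diag s x j u. Qed.

Let center_close j u : (N u (c j u) <= 4 ^ m)%N.
Proof.
apply: N_gap; apply: leq_ltn_trans x_lt; apply: leq_trans (center_le j u).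
by rewrite leq_pmulr// expn_gt0.
Qed.

Let center_top u v : (N u v <= 4 ^ m)%N -> c 0%N u = c 0%N v.
Proof.
move=> uv.
have ball a b w : (N a b <= 4 ^ m)%N -> (N b w * 4 ^ 0 <= x)%N -> (N a w * 4 ^ 0 <= x)%N.
  rewrite !muln1 => ab bw; apply: leq_trans x_ge; apply: N_close_trans ab _.
  by apply: N_gap; exact: leq_ltn_trans bw x_lt.
have [cv cmin] := cluster_centerP N_diag s x 0 v.
apply: cluster_center_unique => //; first exact: ball cv.
by move=> w uw; apply: cmin; apply: ball uw; rewrite N_sym.
Qed.

Let center_bottom u : c m.+1 u = u.
Proof.
apply: cluster_center_unique => //; first by rewrite N_diag.
move=> w uw; suff -> : w = u by [].
apply/esym/(@steps_eq0 _ C _ p delta); apply/eqP; rewrite -leqn0 -ltnS.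
have := leq_ltn_trans uw x_lt; rewrite -[X in (_ < X)%N]mul1n ltn_pmul2r//.
by rewrite expn_gt0.
Qed.

Let q a b := s2val (cid2 (steps_coupling C_ge0 C_diag p_pmf delta_gt0 a b)).

Let q_joint a b : joint_pmf (p a) (p b) (q a b).
Proof. exact: (s2valP (cid2 (steps_coupling C_ge0 C_diag p_pmf delta_gt0 a b))). Qed.

Let q_cost a b : (N a b <= 4 ^ m)%N -> (joint_cost C (q a b) <= (delta * (N a b)%:R)%:E)%E.
Proof.
rewrite steps_fin.
exact: (s2valP' (cid2 (steps_coupling C_ge0 C_diag p_pmf delta_gt0 a b))).
Qed.

Let sep j u v : R := (c j u != c j v)%:R.

Let bound M u v : \bar R := if (N u v <= 4 ^ m)%N then
  (40 / 3 * delta * x%:R * \sum_(j < M.+1) sep j u v * (4 ^- j - 4 ^- M.+1))%:E else +oo%E.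

Let edge_cost M u :
  (joint_cost C (q (c M u) (c M.+1 u)) <= (5 * delta * x%:R * 4 ^- M.+1)%:E)%E.
Proof.
have cu : (N (c M u) (c M.+1 u) <= 4 ^ m)%N.
  by apply: (N_close_trans (b := u)); [rewrite N_sym|]; exact: center_close.
apply: le_trans (q_cost cu) _; rewrite lee_fin.
have p4 k : 0 < 4 ^+ k :> R by rewrite exprn_gt0.
have near k : (N u (c k u))%:R <= x%:R * 4 ^- k :> R.
  by rewrite ler_pdivlMr// -natrX -natrM ler_nat center_le.
apply: le_trans (_ : delta * (x%:R * 4 ^- M + x%:R * 4 ^- M.+1) <= _).
  rewrite ler_pM2l//; apply: le_trans (lerD (near M) (near M.+1)).
  by rewrite -natrD ler_nat (N_sym u (c M u)) N_tri.
rewrite exprS invfM le_eqVlt; apply/orP; left; apply/eqP; field.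
by rewrite gt_eqF.
Qed.

Let bound_ge0 M u v : (0 <= bound M u v)%E.
Proof.
rewrite /bound; case: ifP => // _; rewrite lee_fin mulr_ge0//.
  by rewrite !mulr_ge0// ltW.
apply: sumr_ge0 => j _; rewrite mulr_ge0// subr_ge0.
by rewrite lef_pV2 ?posrE ?exprn_gt0// ler_weXn2l ?ler1n// ltnW.
Qed.

(** Let [j] be the first level at which the centers of [u] and [v] differ.
    The step from a center to the next one at level [k] costs at most 5
    delta x / 4 ^ k, by the triangle inequality through the point itself.
    These steps are counted for both points from [k = j] on, and their
    geometric sum is 40 / 3 times the radius at level [j]. For the
    induction over the levels, the bound is a sum over all the levels
    where the centers differ; its term at such a level is the total cost
    of the steps from there to the present level. *)
Lemma hierarchical_coupling : attainable C p (fun u v => if (N u v <= 4 ^ m)%N then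
  (40 / 3 * delta * x%:R * \sum_(j < m.+2) sep j u v * 4 ^- j)%:E else +oo%E).
Proof.
have [a0 _] : exists a0 : A, a0 \in predT.
  by apply/existsP; rewrite -[X in is_true X]/(~~ pred0b predT) /pred0b -lt0n ltnW.
have bound0 u v : c 0 u <> c 0 v -> bound 0 u v = +oo%E.
  by rewrite /bound; case: ifP => // /center_top.
have boundS M u v : ~ (forall j, (j <= M.+1)%N -> c j u = c j v) ->
  (bound M u v + joint_cost C (q (c M u) (c M.+1 u)) + joint_cost C (q (c M v) (c M.+1 v))
    <= bound M.+1 u v)%E.
  move=> ne; rewrite /bound; case: ifP => // _; last by rewrite leey.
  apply: le_trans (leeD (leeD (lexx _) (edge_cost M u)) (edge_cost M v)) _.
  rewrite -!EFinD lee_fin.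
  (* the chains have parted at some level, so the sum grows at least by the
     cost of the two new steps *)
  have sep1 : 1 <= \sum_(j < M.+2) sep j u v.
    have [j [jM cj]] : exists j, (j < M.+2)%N /\ c j u != c j v.
      apply: contrapT => /forallNP none; apply: ne => j jM.
      by apply/eqP; apply: contrapT => /negP cj; apply: (none j).
    rewrite (bigD1 (Ordinal jM))//= /sep cj lerDl.
    by apply: sumr_ge0 => i _; exact: ler0n.
  set t := 4 ^- M.+1 : R.
  have tS : 4 ^- M.+2 = t / 4 :> R by rewrite exprSr invfM.
  have t0 : 0 < t by rewrite invr_gt0 exprn_gt0.
  have -> : \sum_(j < M.+2) sep j u v * (4 ^- j - 4 ^- M.+2) =
      \sum_(j < M.+1) sep j u v * (4 ^- j - t) + 3 / 4 * t * \sum_(j < M.+2) sep j u v.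
    transitivity (\sum_(j < M.+2) sep j u v * (4 ^- j - t) + 3 / 4 * t * \sum_(j < M.+2) sep j u v).
      rewrite mulr_sumr -big_split/=; apply: eq_bigr => j _; rewrite tS.
      by field; rewrite gt_eqF// exprn_gt0.
    by rewrite big_ord_recr/= subrr mulr0 addr0.
  rewrite [leRHS]mulrDr -addrA lerD2l.
  apply: le_trans (_ : 40 / 3 * delta * x%:R * (3 / 4 * t * 1) <= _).
    by rewrite le_eqVlt; apply/orP; left; apply/eqP; field.
  by rewrite ler_wpM2l ?ler_wpM2l// ?mulr_ge0 ?mulr_ge0// ltW.
have [d [T [mu [D [Y [mD mY lY _ costY]]]]]] :=
  chain_coupling C_ge0 C_diag C_sym C_tri p_pmf q_joint bound_ge0 bound0 boundS m.+1.
apply: (attainable_variables C_ge0 a0 (mu := mu) mD mY) => [u i|u v].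
  by rewrite -[in RHS](center_bottom u); exact: lY.
apply: le_trans (costY u v) _; rewrite /bound; case: ifP => // _.
rewrite lee_fin ler_wpM2l//; first by rewrite !mulr_ge0// ltW.
apply: ler_sum => j _; rewrite ler_wpM2l// ?ler0n// gerBl.
by rewrite invr_ge0 exprn_ge0.
Qed.

End fixed_sample.

Lemma attainable_le b b' : (forall u v, (b u v <= b' u v)%E) ->
  attainable C p b -> attainable C p b'.
Proof.
move=> bb' [w [w0 w1 w2]]; exists w; split => // u v.
exact: le_trans (w2 u v) (bb' u v).
Qed.

Let Z : R := \sum_(4 ^ m <= x < 4 ^ m.+1) x%:R^-1.

Let Z_gt0 : 0 < Z.
Proof.
have ln2 := ln2_ge R; apply: lt_le_trans (harmonic_scales_ge R m).
by have ln2_gt0 : 0 < ln 2 :> R; [lra|lra].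
Qed.

Let sum_samples (F : {perm A} -> nat -> R) :
  \sum_(i : {perm A} * 'I_(4 ^ m.+1) | (4 ^ m <= i.2)%N) F i.1 i.2 =
  \sum_(s : {perm A}) \sum_(4 ^ m <= x < 4 ^ m.+1) F s x.
Proof.
under [RHS]eq_bigr do rewrite big_geq_mkord.
by rewrite pair_big/=; apply: eq_bigl => i.
Qed.

Let perms_gt0 : 0 < #|{perm A}|%:R :> R.
Proof. by rewrite ltr0n; apply/card_gt0P; exists 1%g. Qed.

(** Mixture of the hierarchical couplings over all orders and scales, the
    scale [x] having a weight proportional to 1 / x. *)
Theorem random_hierarchy_coupling : attainable C p (fun u v =>
  ((229 / 10 * ln #|A|%:R)%:E * (discrete_cost C (p u) (p v) + delta%:E))%E).
Proof.
pose W (i : {perm A} * 'I_(4 ^ m.+1)) : R := (#|{perm A}|%:R * Z * i.2%:R)^-1.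
pose P (i : {perm A} * 'I_(4 ^ m.+1)) := (4 ^ m <= i.2)%N.
have W0 i : P i -> 0 <= W i by rewrite invr_ge0 !mulr_ge0// ltW.
have W1 : \sum_(i | P i) W i = 1.
  rewrite (sum_samples (fun s x => (#|{perm A}|%:R * Z * x%:R)^-1)).
  under eq_bigr do under eq_bigr do rewrite invfM.
  under eq_bigr do rewrite -mulr_sumr.
  rewrite sumr_const -/Z invfM -[LHS]mulr_natl; field.
  by rewrite !gt_eqF.
have mix := attainable_mixture C_ge0 W0 W1
  (fun i Pi => hierarchical_coupling i.1 Pi (ltn_ord i.2)).
apply: attainable_le mix => u v.
have lnA : 0 < ln #|A|%:R :> R by rewrite ln_gt0// ltr1n.
have K0 : 0 < 229 / 10 * ln #|A|%:R :> R by rewrite mulr_gt0.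
case h : (N u v <= 4 ^ m)%N; last first.
  move: h; rewrite steps_fin => /negbT; rewrite -leNgt leye_eq => /eqP ->.
  by rewrite addye// mulry gtr0_sg// mul1e leey.
under eq_bigr do rewrite -EFinM.
rewrite sumEFin.
have fin : (discrete_cost C (p u) (p v) < +oo)%E by rewrite -(steps_fin C p delta).
rewrite -(fineK (x := discrete_cost C (p u) (p v))) ?ge0_fin_numE ?discrete_cost_ge0//.
rewrite -EFinD -EFinM lee_fin.
have dN : delta * (N u v)%:R <= fine (discrete_cost C (p u) (p v)) + delta.
  have [->|uv] := eqVneq u v; last exact: le_steps.
  by rewrite N_diag mulr0 addr_ge0 ?fine_ge0 ?discrete_cost_ge0// ltW.
apply: le_trans (_ : 229 / 10 * ln #|A|%:R * (delta * (N u v)%:R) <= _); last first.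
  by rewrite ler_pM2l.
pose sep (s : {perm A}) x j : R := (cluster_center N s x j u != cluster_center N s x j v)%:R.
have -> : \sum_(i | P i) W i * (40 / 3 * delta * i.2%:R *
      \sum_(j < m.+2) sep i.1 i.2 j * 4 ^- j) =
    40 / 3 * delta / (#|{perm A}|%:R * Z) *
      \sum_(s : {perm A}) \sum_(4 ^ m <= x < 4 ^ m.+1) \sum_(j < m.+2) sep s x j / 4 ^+ j.
  rewrite -(sum_samples (fun s x => \sum_(j < m.+2) sep s x j / 4 ^+ j)) mulr_sumr.
  apply: eq_bigr => i Pi; rewrite mulrA; congr (_ * _); rewrite /W; field.
  rewrite !gt_eqF// ltr0n (leq_trans _ Pi)// expn_gt0//.
have cuts := expected_cut_scales N_diag N_sym N_tri R m u v.
apply: le_trans (_ : 40 / 3 * delta / (#|{perm A}|%:R * Z) *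
  (#|{perm A}|%:R * (\sum_(k < #|A|) k.+1%:R^-1) * (N u v)%:R) <= _).
  by rewrite ler_wpM2l// divr_ge0 ?mulr_ge0// ltW// mulr_gt0.
rewrite (_ : _ * _ = (40 / 3 * (\sum_(k < #|A|) k.+1%:R^-1) / Z) * (delta * (N u v)%:R)).
  by rewrite ler_wpM2r ?mulr_ge0 ?distortion_lt// ltW.
by field; rewrite !gt_eqF.
Qed.

End random_hierarchy.

(** * The unit interval and measurability of the distance *)

Section lebesgue_unit_interval.
Context {R : realType}.
Local Open Scope ereal_scope.
Local Notation leb := (@completed_lebesgue_measure R).
Local Notation I := (@unit_interval R).
Local Notation unit := (`[0%R, 1%R[%classic : set R).

Lemma measurable_borel_lebesgue (B : set R) :
  measurable B -> measurable (B : set (lebesgueType R)).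
Proof. by move=> mB; exact: sub_caratheodory. Qed.

Lemma completed_lebesgueE (B : set R) : leb B = lebesgue_measure B.
Proof. by []. Qed.

Lemma measurable_fun_borel_lebesgue d (T : measurableType d) (D : set R) (f : R -> T) :
  measurable D -> measurable_fun D f ->
  measurable_fun (D : set (lebesgueType R)) (f : lebesgueType R -> T).
Proof. by move=> mD mf _ B mB; apply: measurable_borel_lebesgue; exact: mf. Qed.

Lemma unit_intervalE : I = unit `|` [set 1%R].
Proof. by rewrite /unit_interval -(@setUitv1 _ _ _ _ true)// bnd_simp. Qed.

Lemma measurable_unit_interval : measurable I.
Proof. by apply: measurable_borel_lebesgue; exact: measurable_itv. Qed.

Lemma leb_unit_interval (S : set R) : measurable S ->
  leb (I `&` S) = lebesgue_measure (unit `&` S).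
Proof.
move=> mS; rewrite completed_lebesgueE unit_intervalE setIUl measureU//.
- rewrite [X in _ + X](_ : _ = 0) ?adde0//; apply/eqP; rewrite eq_le measure_ge0 andbT.
  by rewrite -(lebesgue_measure_set1 (1%R : R)) le_measure// inE//; apply: measurableI.
- by apply: measurableI => //; exact: measurable_itv.
- by apply: measurableI.
apply/seteqP; split=> // t [[tu _] [/= t1 _]]; move: tu; rewrite t1.
by rewrite /= in_itv/= ltxx andbF.
Qed.

Lemma leb_unit_interval1 : leb I = 1.
Proof.
rewrite -(setIT I) leb_unit_interval// setIT lebesgue_measure_itv/= lte_fin ltr01.
by rewrite -EFinB subr0.
Qed.

End lebesgue_unit_interval.

Section measurable_distance.
Context {R : realType} {X : completeMetricType R}.
Hypothesis hX : separable X.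
Context d (T : measurableType d).

(** By density, the distance from [x t] to [y t] is below [r] exactly
    when, for some point of the dense sequence, the sum of its distances
    to [x t] and [y t] is. *)
Lemma measurable_mdist (D : set T) (x y : T -> borel X) : measurable D ->
  measurable_fun D x -> measurable_fun D y ->
  measurable_fun D (fun t => mdist (x t : X) (y t) : R).
Proof.
move=> mD mx my.
have [s s_dense] := separable_dense_seq hX.
have mball (z : T -> borel X) i : measurable_fun D z ->
    measurable_fun D (fun t => mdist (s i) (z t) : R).
  move=> mz; apply: (measurability _ (RGenInftyO.measurableE R)).
  move=> _ [_ [r ->] <-].
  rewrite (_ : _ @^-1` _ = z @^-1` [set w | mdist (s i) w < r]); last first.
    by apply/seteqP; split=> t; rewrite /= ?in_itv.
  by apply: mz => //; apply: open_borel; exact: open_mdist_lt.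
apply: (measurability _ (RGenInftyO.measurableE R)).
move=> _ [_ [r ->] <-].
rewrite (_ : _ `&` _ = \bigcup_i (D `&`
    (fun t => mdist (s i) (x t) + mdist (s i) (y t)) @^-1` `]-oo, r[)).
  apply: bigcupT_measurable => i; apply: measurable_funD => //; exact: mball.
apply/seteqP; split=> [t [Dt]|t [i _ [Dt]]] /=; rewrite ?in_itv/=.
  move=> xyr; have [|i si] := s_dense (x t) ((r - mdist (x t : X) (y t)) / 2).
    by rewrite divr_gt0// subr_gt0.
  exists i => //; split => //=; rewrite ?in_itv/=.
  have := metric_triangle (s i) (x t : X) (y t); lra.
move=> sr; split => //; rewrite ?in_itv/=; apply: le_lt_trans sr.
by rewrite (metric_sym (s i) (x t)); exact: metric_triangle.
Qed.

End measurable_distance.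

(** * Comparing transport costs with their discretization *)

Section transport.
Context {R : realType} {X : completeMetricType R}.
Hypothesis hX : separable X.
Local Notation leb := (@completed_lebesgue_measure R).
Local Notation I := (@unit_interval R).
Local Notation cost := (expected_cost (X := borel X) (@mdist R X)).
Local Notation W := (transport_cost (X := borel X) (@mdist R X)).
Implicit Types (P Q : probability (borel X) R) (x y : lebesgueType R -> borel X).

Lemma expected_cost_ge0 x y : (0 <= cost x y)%E.
Proof. by apply: integral_ge0 => t _; rewrite lee_fin mdist_ge0. Qed.

Lemma transport_cost_ge0 P Q : (0 <= W P Q)%E.
Proof. by apply: le_ereal_inf_tmp => _ [x [y [_ _ ->]]]; exact: expected_cost_ge0. Qed.

(** A value of [x] in [F] is at distance at least [e] from any value of
    [y] outside the enlargement. *)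
Lemma le_law_enlarge P Q x y F e : has_law P x -> has_law Q y -> closed F -> 0 < e ->
  (e%:E * P F <= cost x y + e%:E * Q (enlarge F e))%E.
Proof.
move=> [mx lx] [my ly] cF e0.
have mI := @measurable_unit_interval R.
have mF := closed_borel cF; have mE := measurable_enlarge F e.
pose bad := I `&` x @^-1` F `\` (I `&` y @^-1` enlarge F e).
have mbad : measurable bad by apply: measurableD; [exact: mx|exact: my].
have bad_cost : (e%:E * leb bad <= cost x y)%E.
  rewrite -integral_cst// /expected_cost.
  apply: le_trans (_ : \int[leb]_(t in bad) (mdist (x t : X) (y t))%:E <= _)%E.
    apply: integral_mono => t [[It xF] ny]; first by rewrite lee_fin ltW.
    rewrite lee_fin leNgt; apply/negP => xy; apply: ny; split => //.
    by exists (x t).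
  apply: ge0_subset_integral; [exact: mbad|exact: mI| | |].
  - apply/measurable_EFinP; exact: measurable_mdist.
  - by move=> t _; rewrite lee_fin mdist_ge0.
  - by move=> t [[]].
rewrite -(lx F mF) -(ly _ mE).
apply: le_trans (_ : e%:E * (leb bad + leb (I `&` y @^-1` enlarge F e)) <= _)%E; last first.
  by rewrite ge0_muleDr ?measure_ge0// leeD2r.
rewrite lee_pmul2l ?lte_fin//.
have mxF := mx mI F mF; have myE := my mI _ mE.
apply: le_trans (measureU2 _ _ _) => //.
apply: le_measure; rewrite ?inE//; first exact: measurableU.
by move=> t xt; have [ty|nty] := pselect ((I `&` y @^-1` enlarge F e) t); [right|left].
Qed.

(** By [le_law_enlarge], couplings of vanishing cost force [P F <= Q
    (enlarge F e)] for every [e], hence [P F <= Q F] for closed [F], and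
    conversely. *)
Lemma transport_cost_eq0 P Q : W P Q = 0%E ->
  forall B, measurable B -> P B = Q B.
Proof.
move=> PQ0; have QP0 : W Q P = 0%E.
  rewrite -PQ0 /transport_cost; congr ereal_inf; apply/seteqP.
  have sym (x y : lebesgueType R -> borel X) : cost x y = cost y x.
    by apply: eq_integral => t _; rewrite metric_sym.
  by split=> _ [x [y [hx hy ->]]]; exists y, x; split.
have le P1 Q1 F : W P1 Q1 = 0%E -> closed F -> (P1 F <= Q1 F)%E.
  move=> t0 cF; apply: le_measure_closed => // [|e e0].
    by rewrite -ge0_fin_numE// fin_num_measure.
  rewrite -(@lee_pmul2l R e%:E) ?lte_fin//; apply/lee_addgt0Pr => d d0.
  have : (W P1 Q1 < d%:E)%E by rewrite t0 lte_fin.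
  move=> /ereal_inf_lt[_ [x [y [hx hy ->]]] xyd].
  apply: le_trans (le_law_enlarge hx hy cF e0) _.
  by rewrite addeC leeD2l// ltW.
apply: eq_measure_closed => [|F cF]; first by rewrite -ge0_fin_numE// fin_num_measure.
by apply/eqP; rewrite eq_le !le.
Qed.

Section discretization.
Variable s : nat -> X.
Hypothesis s_dense : forall (x : X) e, 0 < e -> exists i, mdist (s i) x < e.
Variable eps : R.
Hypothesis eps_gt0 : 0 < eps.

Local Notation C := (fun i j => mdist (s i) (s j)).
Let f : borel X -> nat := cell s eps.

Definition cell_mass P (i : nat) : R := fine (P (cell s eps @^-1` [set i])).

Let mf : measurable_fun setT f.
Proof. by apply: measurable_fun_nat => k; rewrite setTI; exact: measurable_cell. Qed.

Let mfi i : measurable (f @^-1` [set i]).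
Proof. exact: measurable_cell. Qed.

Lemma cell_massE P i : P (f @^-1` [set i]) = (cell_mass P i)%:E.
Proof. by rewrite fineK// fin_num_measure. Qed.

Lemma cell_mass_pmf P : is_pmf (cell_mass P).
Proof.
split=> [i|]; first by rewrite fine_ge0.
transitivity (\sum_(i <oo) P (setT `&` f @^-1` [set i]))%E.
  by apply: eq_eseriesr => i _; rewrite setTI cell_massE.
rewrite -(probability_setT P) -[in RHS](setIT setT) -[X in _ `&` X](preimage_setT f).
by rewrite law_nat// [RHS](@eq_eseriesl _ _ xpredT)// => j; rewrite in_setT.
Qed.

Lemma cost_cell_le (x y : X) : C (f x) (f y) <= mdist x y + 2 * eps.
Proof.
have [xs _] := cellP s_dense x eps_gt0; have [ys _] := cellP s_dense y eps_gt0.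
have := metric_triangle (s (f x)) x (s (f y)); have := metric_triangle x y (s (f y)).
rewrite (metric_sym y (s (f y))); rewrite /f in xs ys *; lra.
Qed.

Lemma cost_le_cell (x y : X) : mdist x y <= C (f x) (f y) + 2 * eps.
Proof.
have [xs _] := cellP s_dense x eps_gt0; have [ys _] := cellP s_dense y eps_gt0.
have := metric_triangle x (s (f x)) y; have := metric_triangle (s (f x)) (s (f y)) y.
rewrite (metric_sym x (s (f x))); rewrite /f in xs ys *; lra.
Qed.

Lemma discrete_cost_le_transport P Q :
  (discrete_cost C (cell_mass P) (cell_mass Q) <= W P Q + (2 * eps)%:E)%E.
Proof.
rewrite -leeBlDr//; apply: le_ereal_inf_tmp => _ [x [y [hx hy ->]]].
rewrite leeBlDr//.
have mI := @measurable_unit_interval R.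
have [mx lx] := hx; have [my ly] := hy.
have mfx : measurable_fun I (f \o x) by exact: measurableT_comp.
have mfy : measurable_fun I (f \o y) by exact: measurableT_comp.
have lfx i : leb (I `&` (f \o x) @^-1` [set i]) = (cell_mass P i)%:E.
  by rewrite -cell_massE -lx.
have lfy i : leb (I `&` (f \o y) @^-1` [set i]) = (cell_mass Q i)%:E.
  by rewrite -cell_massE -ly.
have [q jq qE] := joint_pmf_law mI mfx mfy lfx lfy.
apply: le_trans (_ : joint_cost C q <= _)%E; first by apply: ereal_inf_lbound; exists q.
rewrite -(integral_joint_cost (C := C) (fun i j => mdist_ge0 _ _) mI mfx mfy qE).
have -> : (2 * eps)%:E = (\int[leb]_(t in I) (cst (2 * eps)%:E) t)%E.
  by rewrite integral_cst// [X in (_ * X)%E]leb_unit_interval1 mule1.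
rewrite -ge0_integralD.
- by apply: integral_mono => t _; rewrite ?lee_fin ?mdist_ge0//; exact: cost_cell_le.
- exact: mI.
- by move=> t _; rewrite lee_fin mdist_ge0.
- by apply/measurable_EFinP; exact: measurable_mdist.
- by move=> t _; rewrite lee_fin mulr_ge0// ltW.
- exact: measurable_cst.
Qed.

End discretization.
End transport.

(** * Realizing a joint law of cells on the unit interval *)

Section realize_attainable.
Context {R : realType} {X : completeMetricType R}.
Hypothesis hX : separable X.
Local Notation leb := (@completed_lebesgue_measure R).
Local Notation I := (@unit_interval R).
Local Notation cost := (expected_cost (X := borel X) (@mdist R X)).
Local Notation unit := (`[0%R, 1%R[%classic : set R).
Variable s : nat -> X.
Hypothesis s_dense : forall (x : X) e, 0 < e -> exists i, mdist (s i) x < e.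
Variable eps : R.
Hypothesis eps_gt0 : 0 < eps.
Local Notation C := (fun i j => mdist (s i) (s j)).
Local Notation f := (cell s eps : borel X -> nat).
Variables (A : finType) (P : A -> probability (borel X) R).
Let p a := cell_mass s eps (P a).

Let mf i : measurable (f @^-1` [set i]).
Proof. exact: measurable_cell. Qed.

Let p_ge0 u i : 0 <= p u i. Proof. by rewrite fine_ge0. Qed.

Let sum_delta (h : nat -> \bar R) j : (forall i, 0 <= h i)%E ->
  (\sum_(i <oo) h i * (j == i)%:R%:E = h j)%E.
Proof.
move=> h0; rewrite (nneseriesD1 (n := j))//; last by move=> i _; rewrite mule_ge0// lee_fin.
rewrite eqxx mule1 eseries0 ?adde0// => i _ /=.
by rewrite eq_sym => /negbTE ->; rewrite mule0.
Qed.

Section realization_of_weights.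
Variable w : nat -> R.
Hypothesis w_ge0 : forall k, 0 <= w k.
Hypothesis w_marginal : forall a i, (\sum_(k <oo) (w k * (label k a == i)%:R)%:E = (p a i)%:E)%E.

Let w_total (u : A) : (\sum_(k <oo) (w k)%:E = 1%:E)%E.
Proof.
have [_ <-] := cell_mass_pmf s_dense eps_gt0 (P u).
transitivity (\sum_(k <oo) \sum_(i <oo) (w k * (label k u == i)%:R)%:E)%E.
  apply: eq_eseriesr => k _; rewrite -[LHS](sum_delta (h := fun=> (w k)%:E) (label k u))//.
  by move=> _; rewrite lee_fin.
rewrite nneseries_interchange; last by move=> i j; rewrite lee_fin mulr_ge0.
by apply: eq_eseriesr => i _; exact: w_marginal.
Qed.

Let w_le k u : w k <= p u (label k u).
Proof.
rewrite -lee_fin -w_marginal (nneseriesD1 (n := k))//; last first.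
  by move=> j _; rewrite lee_fin mulr_ge0.
by rewrite eqxx mulr1 leeDl// nneseries_ge0// => j _ _; rewrite lee_fin mulr_ge0.
Qed.

Let share k u B : \bar R :=
  ((w k / p u (label k u))%:E * P u (B `&` f @^-1` [set label k u]))%E.

Let share_total k u : share k u setT = (w k)%:E.
Proof.
rewrite /share setTI (cell_massE s_dense eps_gt0) -EFinM; congr EFin.
have [p0|p0] := eqVneq (p u (label k u)) 0; last by rewrite divfK.
by rewrite -/(p u _) p0 mulr0; apply/eqP; rewrite eq_le w_ge0/= -p0 w_le.
Qed.

Let realize_share k u : exists g : R -> borel X, measurable_fun setT g /\
  forall B, measurable B -> lebesgue_measure (slot 0%R w k `&` g @^-1` B) = share k u B.
Proof.
have r0 : 0 <= w k / p u (label k u) by rewrite divr_ge0.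
pose nu : {measure set (borel X) -> \bar R} :=
  mscale (NngNum r0) (mrestr (P u) (mf (label k u))).
have nuE B : nu B = share k u B by [].
have nu_fin : (nu setT < +oo)%E by rewrite nuE share_total ltry.
have [g mg gB] := realize_measure_on_interval (slot_start 0 w k) nu_fin s_dense.
exists g; split => // B mB; rewrite -nuE -gB// nuE share_total /slot slot_startS.
by [].
Qed.

(** On the slot of the code [k] the cell of each variable is fixed by [k],
    and the variable [x u] is distributed over it like [P u] restricted to
    that cell, scaled to the length of the slot. Summing over the codes
    recovers [P u] by the marginal condition. The values lie in their
    cells only almost everywhere, which is enough for the costs. *)
Lemma realize_weights : exists2 x : A -> lebesgueType R -> borel X, coupling P x &
  forall u v, (cost (x u) (x v) <=
    \sum_(k <oo) (w k * C (label k u) (label k v))%:E + (2 * eps)%:E)%E.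
Proof.
have [g gP] : exists g : nat -> A -> R -> borel X, forall k u, measurable_fun setT (g k u) /\
    forall B, measurable B -> lebesgue_measure (slot 0%R w k `&` g k u @^-1` B) = share k u B.
  exists (fun k u => sval (cid (realize_share k u))) => k u.
  exact: (svalP (cid (realize_share k u))).
pose Z := slot_index 0%R w.
pose x (u : A) (t : R) : borel X := g (Z t) u t.
have unitE (u : A) : unit = \bigcup_k slot 0%R w k.
  by have := @slot_cover _ 0 _ _ w_ge0 (w_total u); rewrite add0r.
have slotZ t k : slot 0%R w k t -> Z t = k by exact: slot_indexE.
have preZ (u : A) k : unit `&` Z @^-1` [set k] = slot 0%R w k.
  by have := @slot_index_preimage _ 0 _ _ w_ge0 (w_total u) k; rewrite add0r.
have mZ (u : A) : measurable_fun setT Z.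
  apply: measurable_fun_nat => k; rewrite -(setUCl unit) setIUl; apply: measurableU.
    have [k0|k0] := pselect (0%N = k).
      rewrite (_ : _ `&` _ = ~` unit); first by apply: measurableC; exact: measurable_itv.
      apply/seteqP; split=> [t []//|t nt]; split => //=.
      rewrite -k0 /Z /slot_index; case: xgetP => // i _ it.
      by exfalso; apply: nt; rewrite (unitE u); exists i.
    rewrite (_ : _ `&` _ = set0)//; apply/seteqP; split=> // t [nt /= tk].
    apply: k0; rewrite -tk /Z /slot_index; case: xgetP => // i _ it.
    by exfalso; apply: nt; rewrite (unitE u); exists i.
  by rewrite (preZ u); exact: measurable_slot.
have mx u : measurable_fun setT (x u).
  move=> _ B mB; rewrite setTI.
  have -> : x u @^-1` B = \bigcup_k (Z @^-1` [set k] `&` g k u @^-1` B).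
    apply/seteqP; split=> [t tB|t [k _ [/= <-]]]//.
    by exists (Z t).
  apply: bigcupT_measurable => k; apply: measurableI.
    by rewrite -[X in measurable X]setTI; exact: mZ.
  by rewrite -[X in measurable X]setTI; apply: (gP k u).1.
have law_sum (u : A) (S : set R) : measurable S ->
    lebesgue_measure (unit `&` S) = (\sum_(k <oo) lebesgue_measure (slot 0%R w k `&` S))%E.
  move=> mS; rewrite (unitE u) setI_bigcupl measure_bigcup//.
  - by rewrite [LHS](@eq_eseriesl _ _ xpredT)// => k; rewrite in_setT.
  - by move=> k _; apply: measurableI => //; exact: measurable_slot.
  apply/trivIsetP => i j _ _ ij; apply/seteqP; split=> // t [[ti _] [tj _]].
  by rewrite (slot_inj w_ge0 ti tj) eqxx in ij.
have lawx u B : measurable B -> lebesgue_measure (unit `&` x u @^-1` B) = P u B.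
  move=> mB; rewrite (law_sum u); last by rewrite -[X in measurable X]setTI; exact: mx.
  transitivity (\sum_(k <oo) share k u B)%E.
    apply: eq_eseriesr => k _; rewrite -(gP k u).2//; congr lebesgue_measure.
    by apply/seteqP; split=> t [tk /= tB]; split => //=; move: tB; rewrite /x (slotZ _ _ tk).
  pose h i := (((p u i)^-1)%:E * P u (B `&` f @^-1` [set i]))%E.
  have h0 i : (0 <= h i)%E by rewrite mule_ge0// lee_fin invr_ge0.
  have h_fin i : h i \is a fin_num.
    rewrite ge0_fin_numE// lte_mul_pinfty// ?lee_fin ?invr_ge0//.
    by rewrite -ge0_fin_numE// fin_num_measure//; exact: measurableI.
  transitivity (\sum_(k <oo) \sum_(i <oo) (w k)%:E * (h i * (label k u == i)%:R%:E))%E.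
    apply: eq_eseriesr => k _; rewrite nneseriesZl; last first.
      by move=> i _; rewrite mule_ge0// lee_fin.
    by rewrite sum_delta// /share /h EFinM muleA.
  rewrite nneseries_interchange; last first.
    move=> i j; apply: mule_ge0; first by rewrite lee_fin.
    by apply: mule_ge0 => //; rewrite lee_fin ler0n.
  transitivity (\sum_(i <oo) P u (B `&` f @^-1` [set i]))%E.
    apply: eq_eseriesr => i _.
    transitivity (\sum_(k <oo) h i * (w k * (label k u == i)%:R)%:E)%E.
      by apply: eq_eseriesr => k _; rewrite EFinM muleCA.
    rewrite -(fineK (h_fin i)).
    rewrite nneseriesZl; last by move=> k _; rewrite lee_fin mulr_ge0.
    rewrite w_marginal fineK//.
    rewrite /h muleAC -EFinM; have [p0|p0] := eqVneq (p u i) 0.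
      rewrite p0 mulr0 mul0e; apply/esym/eqP; rewrite eq_le measure_ge0 andbT.
      rewrite -[leRHS]/(0%:E) -p0 -(cell_massE s_dense eps_gt0); apply: le_measure; rewrite ?inE//.
        exact: measurableI.
    by rewrite mulVf// mul1e.
  rewrite -[in RHS](setIT B) -[X in _ `&` X](preimage_setT f) law_nat//.
    by rewrite [RHS](@eq_eseriesl _ _ xpredT)// => j; rewrite in_setT.
  apply: measurable_fun_nat => k; exact: measurableI.
have mI := @measurable_unit_interval R.
have mxI u : measurable_fun I (x u : lebesgueType R -> borel X).
  apply: measurable_fun_borel_lebesgue; first exact: measurable_itv.
  exact: measurable_funS (mx u).
exists x => [u|u v].
  split; first exact: mxI.
  move=> B mB; rewrite leb_unit_interval ?lawx//.
  by rewrite -[X in measurable X]setTI; exact: mx.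
have mZI : measurable_fun I (Z : lebesgueType R -> nat).
  apply: measurable_fun_borel_lebesgue; first exact: measurable_itv.
  exact: measurable_funS (mZ u).
pose bad a := [set t | f (x a t) <> label (Z t) a].
have bad_negl a : leb.-negligible (I `&` bad a).
  have mbad : measurable (bad a : set R).
    pose fx t := f (x a t).
    have mfx : measurable_fun setT fx.
      apply: (measurableT_comp _ (mx a)).
      by apply: measurable_fun_nat => k; rewrite setTI; exact: mf.
    rewrite (_ : bad a = \bigcup_k \bigcup_(i in [set i | i <> label k a])
        (Z @^-1` [set k] `&` fx @^-1` [set i])).
      apply: bigcupT_measurable => k; apply: bigcup_measurable => i _; apply: measurableI.
        by rewrite -[X in measurable X]setTI; exact: mZ.
      by rewrite -[X in measurable X]setTI; exact: mfx.
    apply/seteqP; split=> [t tb|t [k _ [i ik [/= tk ti]]]].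
      by exists (Z t) => //; exists (fx t).
    by rewrite /bad /= -/(fx t) ti tk.
  exists (I `&` bad a); split => //.
    by apply: measurableI => //; exact: measurable_borel_lebesgue.
  rewrite leb_unit_interval// (law_sum a)// eseries0// => k _ _.
  rewrite (_ : _ `&` _ = slot 0 w k `&` g k a @^-1` (~` (f @^-1` [set label k a]))).
    rewrite (gP k a).2; last exact: measurableC.
    by rewrite /share setICl measure0 mule0.
  by apply/seteqP; split=> t [tk]; rewrite /bad /= /x (slotZ _ _ tk) => h; split.
pose H k : R := C (label k u) (label k v) + 2 * eps.
have H0 k : 0 <= H k by rewrite addr_ge0 ?mdist_ge0// mulr_ge0// ltW.
apply: (@le_trans _ _ (\int[leb]_(t in I) (H (Z t))%:E)%E).
  apply: ae_ge0_le_integral.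
  - exact: mI.
  - by move=> t _; rewrite lee_fin mdist_ge0.
  - by apply/measurable_EFinP; exact: measurable_mdist.
  - by move=> t _; rewrite lee_fin.
  - exact: (measurable_nat_comp (fun k => (H k)%:E)).
  apply: negligibleS (negligibleU (bad_negl u) (bad_negl v)) => t /= nt.
  have It : I t by apply: contrapT => nI; apply: nt.
  apply: contrapT => /not_orP[nu nv]; apply: nt => _; rewrite lee_fin /H.
  have fu : f (x u t) = label (Z t) u by apply: contrapT => h; apply: nu.
  have fv : f (x v t) = label (Z t) v by apply: contrapT => h; apply: nv.
  by rewrite -fu -fv; exact: cost_le_cell.
rewrite (integral_nat_valued leb (h := fun k => (H k)%:E))//.
rewrite -[X in (_ <= _ + X)%E]mule1 -(w_total u).
rewrite -nneseriesZl; last by move=> k _; rewrite lee_fin.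
rewrite -nneseriesD; last 2 first.
- by move=> k _ _; rewrite lee_fin mulr_ge0// mdist_ge0.
- by move=> k _ _; rewrite lee_fin mulr_ge0// mulr_ge0// ltW.
rewrite le_eqVlt; apply/orP; left; apply/eqP; apply: eq_eseriesr => k _.
have lZ : leb (I `&` Z @^-1` [set k]) = (w k)%:E.
  rewrite leb_unit_interval; last by rewrite -[X in measurable X]setTI; exact: mZ.
  by rewrite (preZ u) lebesgue_slot.
by rewrite [X in (_ * X)%E]lZ -EFinM -EFinD /H; congr EFin; ring.
Qed.

End realization_of_weights.

Lemma realize_attainable (b : A -> A -> \bar R) : attainable C p b ->
  exists2 x : A -> lebesgueType R -> borel X, coupling P x &
  forall u v, (cost (x u) (x v) <= b u v + (2 * eps)%:E)%E.
Proof.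
move=> [w [w0 w1 w2]]; have [x Px xc] := realize_weights w0 w1.
by exists x => // u v; apply: le_trans (xc u v) _; rewrite leeD2r.
Qed.

End realize_attainable.

(** * Coupling with logarithmic distortion *)

Section same_law.
Context {R : realType} d {X : measurableType d}.

Definition same_law (P Q : probability X R) : Prop :=
  forall B, measurable B -> P B = Q B.

Lemma has_law_same (P Q : probability X R) x : same_law P Q -> has_law P x -> has_law Q x.
Proof. by move=> PQ [mx lx]; split => // B mB; rewrite lx// PQ. Qed.

Lemma same_law_sym (P Q : probability X R) : same_law P Q -> same_law Q P.
Proof. by move=> PQ B mB; rewrite PQ. Qed.

Lemma le_transport_cost_same (c : X -> X -> R) (P P' Q Q' : probability X R) :
  same_law P P' -> same_law Q Q' -> (transport_cost c P Q <= transport_cost c P' Q')%E.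
Proof.
move=> PP' QQ'; apply: le_ereal_inf => _ [x [y [hx hy ->]]].
exists x, y; split => //; first exact: has_law_same (same_law_sym PP') hx.
exact: has_law_same (same_law_sym QQ') hy.
Qed.

(** Equal laws are identified by a choice that only depends on the law, so
    that they can be given the same variable. *)
Lemma law_representative (A : finType) (P : A -> probability X R) :
  exists rep : A -> A, (forall a, same_law (P (rep a)) (P a)) /\
  forall a b, same_law (P a) (P b) -> rep a = rep b.
Proof.
(* [pick] depends on the predicate only up to extensional equality *)
pose rep a := odflt a [pick b | `[< same_law (P b) (P a) >]].
exists rep; split=> [a|a b ab].
  by rewrite /rep; case: pickP => [b /asboolP//|/=].
rewrite /rep.
have -> : [pick c | `[< same_law (P c) (P a) >]] = [pick c | `[< same_law (P c) (P b) >]].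
  apply: eq_pick => c; apply/asboolP/asboolP => h B mB; rewrite h//.
    exact: ab.
  by rewrite ab.
by case: pickP => // /(_ b)/asboolP[].
Qed.

End same_law.

Lemma positive_minimum (R : realType) (T : finType) (g : T -> R) :
  exists2 eta, 0 < eta & forall t, 0 < g t -> eta <= g t.
Proof.
exists (\big[Order.min/1]_(t | 0 < g t) g t); first by apply: lt_bigmin.
by move=> t gt; exact: bigmin_le_cond.
Qed.

Theorem proposition18 (R : realType) (X : completeMetricType R)
    (hX : separable X) (A : finType) (hA : (2 <= #|A|)%N)
    (P : A -> probability (borel X) R) :
  (optimal_coupling_ratio (X := borel X) (@mdist R X) P
     < (231 / 10 * ln (#|A|%:R : R))%:E)%E.
Proof.
set L := ln (#|A|%:R : R).
have L_ge : 6628 / 10000 <= L.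
  by apply: le_trans (ln2_ge R) _; rewrite ler_ln ?posrE ?ltr0n ?ler_nat// ltnW.
pose W u v := transport_cost (X := borel X) (@mdist R X) (P u) (P v).
have W_ge0 u v : (0 <= W u v)%E by exact: transport_cost_ge0.
have [eta eta_gt0 eta_le] := positive_minimum (fun uv : A * A => fine (W uv.1 uv.2)).
pose K : R := 229 / 10 * L; pose r : R := 230 / 10 * L.
have K_gt0 : 0 < K by rewrite /K; lra.
(* the rounding unit and the cell size: the errors then add up to the
   difference between [r] and [K] times the least positive cost *)
pose e : R := L / 10 * eta / (3 * K + 2).
have e_gt0 : 0 < e.
  rewrite /e; apply: divr_gt0; last by lra.
  by apply: mulr_gt0 => //; lra.
have eE : K * (3 * e) + 2 * e = L / 10 * eta.
  by rewrite /e; field; apply/eqP; lra.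
have [s s_dense] := separable_dense_seq hX.
have pmfs a := cell_mass_pmf s_dense e_gt0 (P a).
have att := random_hierarchy_coupling (C := fun i j => mdist (s i) (s j))
  (fun i j => mdist_ge0 _ _) (fun i => mdistxx _) (fun i j => metric_sym _ _)
  (fun i j k => metric_triangle _ _ _) pmfs hA e_gt0.
have [x Px xcost] := realize_attainable hX s_dense e_gt0 att.
have [rep [rep_law rep_eq]] := law_representative P.
pose y u := x (rep u).
have Py : coupling P y by move=> u; apply: has_law_same (rep_law u) (Px _).
apply: (@le_lt_trans _ _ r%:E); last by rewrite lte_fin /r; lra.
apply: (@le_trans _ _ (coupling_ratio (X := borel X) (@mdist R X) P y)).
  by apply: ereal_inf_lbound; exists y.
apply: ereal_inf_lbound; exists r => //; split; first by rewrite /r; lra.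
move=> u v; have [uv|uv] := pselect (same_law (P u) (P v)).
  rewrite /y (rep_eq _ _ uv) /expected_cost.
  under eq_integral do rewrite mdistxx.
  rewrite integral0 mule_ge0// ?lee_fin; first by rewrite /r; lra.
  exact: transport_cost_ge0.
have W_neq0 : W u v != 0%E by apply/eqP => W0; apply: uv; exact: transport_cost_eq0 W0.
apply: le_trans (xcost (rep u) (rep v)) _.
rewrite -/(W u v).
have [Wfin|] := ltP (W u v) +oo%E; last first.
  by rewrite leye_eq => /eqP ->; rewrite gt0_muley ?leey// lte_fin /r; lra.
have WE : W u v = (fine (W u v))%:E by rewrite fineK// ge0_fin_numE.
have W_gt0 : 0 < fine (W u v) by rewrite fine_gt0// Wfin lt0e W_neq0 W_ge0.
have eta_W : eta <= fine (W u v) by exact: (eta_le (u, v)).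
set w := fine (W u v) in WE W_gt0 eta_W.
apply: (@le_trans _ _ (K%:E * ((w + 2 * e)%:E + e%:E) + (2 * e)%:E)%E).
  apply: leeD2r; apply: lee_wpmul2l; first by rewrite lee_fin ltW.
  apply: leeD2r.
  apply: le_trans (discrete_cost_le_transport hX s_dense e_gt0 _ _) _.
  rewrite EFinD -WE leeD2r//; apply: le_transport_cost_same; exact: rep_law.
rewrite WE -!EFinM -!EFinD lee_fin.
have LW : L / 10 * eta <= L / 10 * w by apply: ler_wpM2l => //; lra.
move: eE; rewrite /r /K in LW *; lra.
Qed.
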